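(* Consider a robust MDP $(\mathcal{S},\mathcal{A},\boldsymbol{r},\mathcal{U},\boldsymbol{p}_0)$ with an sa-rectangular compact uncertainty set $\mathcal{U}$. Then $\max_{\pi\in\Pi_{\sf SD}}\min_{\boldsymbol{P}\in\mathcal{U}}(1-\gamma)R_\gamma(\pi,\boldsymbol{P})$ admits a limit as $\gamma\to1$ and $$\lim_{\gamma\to1}\ \max_{\pi\in\Pi_{\sf SD}}\ \min_{\boldsymbol{P}\in\mathcal{U}}(1-\gamma)R_\gamma(\pi,\boldsymbol{P})=\max_{\pi\in\Pi_{\sf SD}}\ \inf_{\boldsymbol{P}\in\mathcal{U}}R_{\sf avg}(\pi,\boldsymbol{P}).$$
   Context: A robust MDP (RMDP) is a tuple $(\mathcal{S},\mathcal{A},\boldsymbol{r},\mathcal{U},\boldsymbol{p}_0)$: $\mathcal{S}$ (states) and $\mathcal{A}$ (actions) are finite nonempty sets, $\boldsymbol{r}\in\mathbb{R}^{\mathcal{S}\times\mathcal{A}\times\mathcal{S}}$ is the reward function, the uncertainty set $\mathcal{U}\subset\Delta(\mathcal{S})^{\mathcal{S}\times\mathcal{A}}$ is a nonempty compact set of transition probabilities $\boldsymbol{P}=(\boldsymbol{p}_{sa})_{s,a}$, and $\boldsymbol{p}_0\in\Delta(\mathcal{S})$ is the initial distribution. The set $\mathcal{U}$ is sa-rectangular if $\mathcal{U}=\prod_{(s,a)}\mathcal{U}_{sa}$ with $\mathcal{U}_{sa}\subseteq\Delta(\mathcal{S})$. $\Pi_{\sf SD}$ is the finite set of stationary deterministic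 policies $\mathcal{S}\to\mathcal{A}$. $\mathbb{E}_{\pi,\boldsymbol{P}}$ is expectation with respect to the law of $(s_t,a_t)_{t\ge 0}$ induced by $\pi$ and $\boldsymbol{P}$. For $\gamma\in(0,1)$, $$R_\gamma(\pi,\boldsymbol{P})=\mathbb{E}_{\pi,\boldsymbol{P}}\Big[\sum_{t=0}^{+\infty}\gamma^t r_{s_ta_ts_{t+1}}\Big|s_0\sim\boldsymbol{p}_0\Big],\qquad R_{\sf avg}(\pi,\boldsymbol{P})=\mathbb{E}_{\pi,\boldsymbol{P}}\Big[\limsup_{T\to+\infty}\tfrac{1}{T+1}\sum_{t=0}^{T} r_{s_ta_ts_{t+1}}\Big|s_0\sim\boldsymbol{p}_0\Big].$$ *)

(* Defs.v *)
From HB Require Import structures.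
From mathcomp Require Import all_boot all_order all_algebra.
From mathcomp Require Import all_classical all_reals all_analysis.
From mathcomp Require Import lra.

Set Implicit Arguments.
Unset Strict Implicit.
Unset Printing Implicit Defensive.
Import Order.TTheory GRing.Theory Num.Theory.
Import numFieldNormedType.Exports.
Local Open Scope classical_set_scope.
Local Open Scope ring_scope.

(** The library's measurable types are pointed, so nonempty finite sets are
    taken to be finite types with a distinguished point. *)
#[short(type="pointedFinType")]
HB.structure Definition PointedFinite := {T of Pointed T & Finite T}.
HB.instance Definition _ (S A : pointedFinType) := Pointed.on (S * A)%type.

Definition coordinate_events (T : Type) : set (set (nat -> T)) :=
  [set E | exists n x, E = [set w | w n = x]].

(** For finite [T], [coordinate_events] generates the product sigma-algebra
    of the discrete sigma-algebras. *)
Definition trajectory (T : pointedType) :=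
  g_sigma_algebraType (@coordinate_events T).

HB.instance Definition _ (T : pointedType) := Measurable.on (trajectory T).

(** The set written Delta(T) for a finite set [T] *)
Definition simplex (R : realType) (T : finType) : set (T -> R) :=
  [set p | (forall x, 0 <= p x) /\ \sum_x p x = 1].

Definition is_markov_law (R : realType) (T : pointedFinType)
    (q : T -> R) (K : T -> T -> R) (mu : probability (trajectory T) R) :=
  forall n (h : nat -> T),
    mu [set w | forall i, (i < n.+1)%N -> w i = h i] =
      (q (h 0%N) * \prod_(i < n) K (h i) (h i.+1))%:E.

(** The cylinder probabilities determine the law (pi-lambda theorem); it exists
    as soon as [q] and the [K x] are distributions, by [markov_lawP] below. *)
Definition markov_law (R : realType) (T : pointedFinType)
    (q : T -> R) (K : T -> T -> R) : probability (trajectory T) R :=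
  get (is_markov_law q K).

(** Existence of the law of a finite Markov chain: [0, 1[ is cut into
    subintervals indexed by words, of lengths the probabilities of the words,
    and a uniform point of [0, 1[ is mapped to the trajectory whose prefixes
    index the intervals containing it. *)
Section markov_law_exists.
Context (R : realType) (T : pointedFinType) (q0 : T -> R) (K : T -> T -> R).
Hypotheses (q0P : simplex q0) (KP : forall x, simplex (K x)).

Let q (o : option T) (y : T) : R := if o is Some x then K x y else q0 y.

Let q_ge0 o y : 0 <= q o y.
Proof. by case: o => [x|] /=; [have [+ _] := KP x|have [+ _] := q0P]; exact. Qed.

Let q_sum1 o : \sum_y q o y = 1.
Proof. by case: o => [x|] /=; [have [_] := KP x|have [_] := q0P]. Qed.

Let G o k : R := \sum_(z | (enum_rank z < k)%N) q o z.

Let GS o y : G o (enum_rank y).+1 = G o (enum_rank y) + q o y.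
Proof.
rewrite /G (bigD1 y)//= addrC; congr (_ + _); apply: eq_bigl => z.
rewrite ltnS ltn_neqAle andbC; congr (_ && _).
by rewrite -(inj_eq enum_rank_inj) -(inj_eq val_inj).
Qed.

Let G_le o k l : (k <= l)%N -> G o k <= G o l.
Proof.
move=> kl; rewrite /G [leRHS](bigID (fun z => (enum_rank z < k)%N))/=.
rewrite [X in _ <= X + _](_ : _ = \sum_(z | (enum_rank z < k)%N) q o z).
  by rewrite lerDl sumr_ge0.
apply: eq_bigl => z; case: (ltnP _ k) => h; rewrite ?andbT ?andbF//.
by rewrite (leq_trans h).
Qed.

Let inside o (a p u : R) y := (a + p * G o (enum_rank y) <= u <
  a + p * G o (enum_rank y) + p * q o y).

Let inside_ex o a p u : a <= u < a + p -> exists y, inside o a p u y.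
Proof.
move=> /andP[au ua].
have uT : u < a + p * G o #|T|.
  rewrite /G (eq_bigl xpredT) ?q_sum1 ?mulr1// => z.
  by rewrite ltn_ord.
have ex : exists k, u < a + p * G o k by exists #|T|.
case: (ex_minnP ex) => -[|k] uk kmin.
  by move: uk; rewrite /G big_pred0// mulr0 addr0 ltNge au.
have k_lt : (k < #|T|)%N by exact: kmin.
exists (enum_val (Ordinal k_lt)); rewrite /inside -addrA -mulrDr -GS enum_valK/=.
rewrite uk andbT leNgt; apply/negP => /kmin.
by rewrite ltnn.
Qed.

Let inside_uniq o a p u y z : a <= u < a + p ->
  inside o a p u y -> inside o a p u z -> y = z.
Proof.
move=> /andP[au ua]; have p0 : 0 < p by lra.
wlog yz : y z / (enum_rank y < enum_rank z)%N.
  move=> H; case: (ltngtP (enum_rank y) (enum_rank z)) => [yz|zy|].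
  - exact: H.
  - by move=> iy iz; apply/esym/H.
  - by move=> /val_inj/enum_rank_inj.
rewrite /inside => /andP[_ uy] /andP[zu _]; exfalso.
have : p * G o (enum_rank y).+1 <= p * G o (enum_rank z).
  by rewrite ler_pM2l// G_le.
by rewrite GS; lra.
Qed.

Let inside_sub o a p u y : 0 <= p -> inside o a p u y -> a <= u < a + p.
Proof.
move=> p0 /andP[yu uy].
have G0 : 0 <= G o (enum_rank y) by rewrite sumr_ge0.
have G1 : G o (enum_rank y) + q o y <= 1.
  rewrite -GS -(q_sum1 o) /G.
  rewrite [leRHS](bigID (fun z => (enum_rank z < (enum_rank y).+1)%N))/=.
  by rewrite lerDl sumr_ge0.
by apply/andP; split; nra.
Qed.

Let step (u : R) (s : option T * R * R) : option T * R * R :=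
  let: (o, a, p) := s in
  let y := odflt point [pick y | inside o a p u y] in
  (Some y, a + p * G o (enum_rank y), p * q o y).

Let st u n := iter n (step u) (None, 0, 1).

Let prev (h : nat -> T) n := if n is m.+1 then Some (h m) else None.

Let Fixpoint wst (h : nat -> T) n : R * R := if n is m.+1 then
    let: (a, p) := wst h m in
    (a + p * G (prev h m) (enum_rank (h m)), p * q (prev h m) (h m))
  else (0, 1).

Let X (u : measurableTypeR R) : trajectory T := fun n =>
  if 0 <= u < 1 then odflt point (st u n.+1).1.1 else point.

Let wst_ge0 h n : 0 <= (wst h n).2.
Proof.
by elim: n => [|n] /=; [lra|case: (wst h n) => a p /= p0; rewrite mulr_ge0].
Qed.

Let stP u h n : 0 <= u < 1 ->
  (forall i, (i < n)%N -> X u i = h i) <->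
  (wst h n).1 <= u < (wst h n).1 + (wst h n).2.
Proof.
move=> u01; suff [//] : ((forall i, (i < n)%N -> X u i = h i) <->
  (wst h n).1 <= u < (wst h n).1 + (wst h n).2) /\
  ((wst h n).1 <= u < (wst h n).1 + (wst h n).2 ->
   st u n = (prev h n, (wst h n).1, (wst h n).2)).
elim: n => [|n [IH1 IH2]]; first by split => //=; rewrite add0r.
have p0 := wst_ge0 h n.
have XE a p : st u n = (prev h n, a, p) ->
    X u n = odflt point [pick y | inside (prev h n) a p u y].
  by move=> E; rewrite /X u01 /st iterS -/(st u n) E.
case Ew : (wst h n) IH1 IH2 p0 => [a p] /= IH1 IH2 p0; rewrite Ew/=.
split; first split.
- move=> H.
  have uap : a <= u < a + p by apply/IH1 => i ni; apply: H; exact: ltnW.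
  have := H n (ltnSn n); rewrite (XE _ _ (IH2 uap)).
  case: pickP => [y iy /= <-//|no].
  by have [y] := inside_ex (prev h n) uap; rewrite no.
- move=> iu; have uap := inside_sub p0 iu.
  move=> i; rewrite ltnS leq_eqVlt => /orP[/eqP ->|]; last exact: (IH1.2 uap).
  rewrite (XE _ _ (IH2 uap)); case: pickP => [y iy /=|/(_ (h n))].
    exact: inside_uniq uap iy iu.
  by rewrite [inside _ _ _ _ _]iu.
- move=> iu; have uap := inside_sub p0 iu.
  rewrite -[LHS]/(step u (st u n)) (IH2 uap)/=.
  have -> : [pick y | inside (prev h n) a p u y] = Some (h n).
    case: pickP => [y iy /=|/(_ (h n))].
      by rewrite (inside_uniq uap iy iu).
    by rewrite [inside _ _ _ _ _]iu.
  by [].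
Qed.

Let I01 : set R := `[0, 1[.

Let cylE h n : (X @^-1` [set w | forall i, (i < n)%N -> w i = h i]) `&` I01 =
  `[(wst h n).1, (wst h n).1 + (wst h n).2[ `&` I01.
Proof.
apply/seteqP; split => u [/= A]; rewrite /I01/= in_itv/= => u01; split => //.
  by rewrite /= in_itv/=; apply/stP.
by apply/stP => //; move: A; rewrite in_itv.
Qed.

Let wst_sub h n : 0 <= (wst h n).1 /\ (wst h n).1 + (wst h n).2 <= 1.
Proof.
elim: n => [|n] /=; first by split; lra.
have := wst_ge0 h n; case: (wst h n) => a p /= p0 [a0 a1].
set o := prev h n; set y := h n.
have G0 : 0 <= G o (enum_rank y) by rewrite sumr_ge0.
have G1 : G o (enum_rank y) + q o y <= 1.
  rewrite -GS -(q_sum1 o) /G.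
  rewrite [leRHS](bigID (fun z => (enum_rank z < (enum_rank y).+1)%N))/=.
  by rewrite lerDl sumr_ge0.
by split; nra.
Qed.

Let cylE' h n : (X @^-1` [set w | forall i, (i < n)%N -> w i = h i]) `&` I01 =
  `[(wst h n).1, (wst h n).1 + (wst h n).2[%classic.
Proof.
rewrite cylE; apply/setIidl => u; rewrite /I01/= !in_itv/=.
by case: (wst_sub h n) => ? ? /andP[? ?]; apply/andP; split; lra.
Qed.

Let mI01 : measurable I01.
Proof. exact: measurable_itv. Qed.

Let mX : measurable_fun [set: measurableTypeR R] X.
Proof.
apply: (@measurability _ _ _ (trajectory T) setT X (@coordinate_events T)) => // _ [_ [n [x ->]] <-].
rewrite setTI -(setIT (_ @^-1` _)) -(setUv I01) setIUr; apply: measurableU; last first.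
  have -> : X @^-1` [set w | w n = x] `&` ~` I01 =
      if x == point then ~` I01 else set0.
    apply/seteqP; split=> u /=.
      move=> []; rewrite /I01 /= in_itv/= /X => Xn /negP u01.
      by move: Xn; rewrite (negbTE u01) => <-; rewrite eqxx /= in_itv/=; apply/negP.
    case: eqP => [->|//] /= u01; split => //.
    by rewrite /X; move: u01; rewrite /I01/= in_itv/= => /negP/negbTE ->.
  by case: ifP => _; [exact: measurableC|exact: measurable0].
pose w (v : {ffun 'I_n.+1 -> T}) i := v (inord i).
have -> : X @^-1` [set w | w n = x] `&` I01 =
    \bigcup_(v in [set v | w v n = x])
      (X @^-1` [set x | forall i, (i < n.+1)%N -> x i = w v i] `&` I01).
  apply/seteqP; split=> u /=.
    move=> [Xn u01]; exists [ffun i : 'I_n.+1 => X u i].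
      by rewrite /= /w ffunE inordK.
    by split => // i ni; rewrite /w ffunE inordK.
  by move=> [v vx [Xv u01]]; split => //=; rewrite Xv.
apply: fin_bigcup_measurable; first exact: finite_finset.
by move=> v _; rewrite cylE'; exact: measurable_itv.
Qed.

Let wst_prod h n : (wst h n.+1).2 = q0 (h 0%N) * \prod_(i < n) K (h i) (h i.+1).
Proof.
elim: n => [|n IH]; first by rewrite big_ord0 /= mul1r mulr1.
by rewrite big_ord_recr/= mulrA -IH /=; case: (wst h n).
Qed.

Let mu0 := mrestr (@lebesgue_measure R) mI01.

Let mu0_setT : mu0 setT = 1%E.
Proof.
rewrite /mu0 /mrestr setTI.
by rewrite /I01 lebesgue_measure_itv/= lte_fin ltr01 oppr0 adde0.
Qed.

HB.instance Definition _ := Measure.on mu0.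

HB.instance Definition _ := Measure_isProbability.Build _ _ _ mu0 mu0_setT.

HB.instance Definition _ := isMeasurableFun.Build _ _ _ _ X mX.

Let mu := distribution (mu0 : probability _ R) (X : {mfun _ >-> trajectory T}).

Lemma markov_law_exists : exists nu, is_markov_law q0 K nu.
Proof.
exists mu => n h; rewrite -wst_prod.
rewrite [LHS](_ : _ = lebesgue_measure
  (`[(wst h n.+1).1, (wst h n.+1).1 + (wst h n.+1).2[%classic : set R)).
  have := wst_ge0 h n.+1; case: (wst h n.+1) => a p /= p_ge0.
  rewrite lebesgue_measure_itv/= lte_fin ltrDl.
  case: ltP => [_|p_le0]; first by rewrite -EFinD addrAC subrr add0r.
  by congr EFin; apply/eqP; rewrite eq_le p_ge0 p_le0.
by rewrite -cylE'.
Qed.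

End markov_law_exists.

Lemma markov_lawP (R : realType) (T : pointedFinType)
    (q : T -> R) (K : T -> T -> R) :
  simplex q -> (forall x, simplex (K x)) ->
  is_markov_law q K (markov_law q K).
Proof. by move=> qP KP; apply: getPex; exact: markov_law_exists. Qed.

(** [{ptws S * A * S -> R}] is the space of functions with the topology of
    pointwise convergence, that is, the usual topology of R^(S x A x S). *)
Definition transitions (R : realType) (S A : pointedFinType) :=
  {ptws S * A * S -> R}.

Definition next_state (R : realType) (S A : pointedFinType)
  (P : transitions R S A) (s : S) (a : A) : S -> R := fun s' => P (s, a, s').

Record rmdp (R : realType) (S A : pointedFinType) := Rmdp {
  reward : S * A * S -> R;
  uncertainty : set (transitions R S A);
  initial : S -> R;
  uncertainty_simplex : forall P, uncertainty P ->
    forall s a, simplex (next_state P s a);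
  uncertainty_nonempty : uncertainty !=set0;
  uncertainty_compact : compact uncertainty;
  initial_simplex : simplex initial }.

Definition sa_rectangular (R : realType) (S A : pointedFinType)
    (U : set (transitions R S A)) :=
  exists Usa : S -> A -> set (S -> R),
    (forall s a, Usa s a `<=` @simplex R S) /\
    U = [set P | forall s a, Usa s a (next_state P s a)].

(** Stationary deterministic policies *)
Definition policy (S A : pointedFinType) := {ffun S -> A}.

(** The default value of the big operator belongs to the family, so this is
    the maximum of [f] over the finite nonempty set of policies. *)
Definition policy_max (R : realType) (S A : pointedFinType)
    (f : policy S A -> R) : R :=
  \big[Num.max/f [ffun=> point]]_(pi : policy S A) f pi.

Section returns.
Context (R : realType) (S A : pointedFinType) (M : rmdp R S A).
Implicit Types (pi : policy S A) (P : transitions R S A).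

Definition start pi (x : S * A) : R :=
  initial M x.1 * (x.2 == pi x.1)%:R.

Definition transition pi P (x y : S * A) : R :=
  P (x, y.1) * (y.2 == pi y.1)%:R.

(** The law of (s_t, a_t)_t when a_t = pi(s_t), s_0 is drawn from the initial
    distribution and s_{t+1} from P(s_t, a_t, .) *)
Definition policy_law pi P : probability (trajectory (S * A)%type) R :=
  markov_law (start pi) (transition pi P).

Definition reward_at (w : trajectory (S * A)%type) (t : nat) : R :=
  reward M (w t, (w t.+1).1).

(** All integrands below are bounded, since the rewards are; [limn] and
    [limn_sup] are thus the actual sum and limit superior. *)
Definition discounted_return (gamma : R) pi P : R :=
  \int[policy_law pi P]_w
    limn (series (fun t => gamma ^+ t * reward_at w t)).

Definition average_return pi P : R :=
  \int[policy_law pi P]_w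
    limn_sup (fun T => T.+1%:R^-1 * \sum_(t < T.+1) reward_at w t).

Let simplex_action pi (p : S -> R) : simplex p ->
  simplex (fun x : S * A => p x.1 * (x.2 == pi x.1)%:R).
Proof.
move=> [p0 p1]; split=> [x|]; first by rewrite mulr_ge0.
transitivity (\sum_s \sum_a p s * (a == pi s)%:R).
  by rewrite (pair_bigA _ (fun s a => p s * (a == pi s)%:R)).
rewrite -[RHS]p1; apply: eq_bigr => s _; rewrite (bigD1 (pi s))//= eqxx mulr1 big1 ?addr0//.
by move=> a /negbTE ->; rewrite mulr0.
Qed.

Lemma policy_lawP pi P : uncertainty M P ->
  is_markov_law (start pi) (transition pi P) (policy_law pi P).
Proof.
move=> UP; apply: markov_lawP => [|[s a]].
  exact: simplex_action (initial_simplex M).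
exact: simplex_action (uncertainty_simplex UP s a).
Qed.

End returns.

(* Main.v *)
Require Import Defs.
From mathcomp Require Import all_boot all_order all_algebra.
From mathcomp Require Import all_classical all_reals all_analysis.
From mathcomp Require Import measurable_realfun.
From mathcomp Require Import ring lra zify.

Import Order.TTheory GRing.Theory Num.Theory.
Import numFieldNormedType.Exports.
Local Open Scope classical_set_scope.
Local Open Scope ring_scope.

Set Implicit Arguments.
Unset Strict Implicit.

(** Fix a policy; the adversary then controls a finite Markov chain. For a single
    kernel, the upper limit of the normalized discounted values is at most the
    expected limsup average (reverse Fatou and Abel summation), so the limit of
    the minima is at most the infimum of the averages.

    Conversely, if the inequality failed along some discount factors tending to
    1, take an ultrafilter along which the discount-optimal kernels k_a, their
    values v_a and their normalized resolvents Q_a converge, to K0, v and Q. With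
    g the limit of the discounted values of K0 and r its mean cost, Q K0 = Q and
    v = Q r = Q g, while v <= g and v <= Q v; hence Q is carried by G = {g = v},
    which is closed for K0. Playing K0 on G and k_a off G, with a close to 1,
    reaches G without losing more than e, and on G the average cost is v: this is
    expressed by functions f <= v + e and h with K f <= f and
    r + K h <= h + f + e. By a martingale argument such f and h bound the
    expected limsup average from above. *)

(** * Kernels on a finite set *)

Definition kapp (R : realType) (T : finType) (K : T -> T -> R) (f : T -> R)
  (x : T) : R := \sum_y K x y * f y.

Section kernels.
Context (R : realType) (T : finType).
Implicit Types (K : T -> T -> R) (f g : T -> R).

Lemma kapp_le K f g x : simplex (K x) -> (forall y, f y <= g y) ->
  kapp K f x <= kapp K g x.
Proof. by move=> [K0 _] fg; apply: ler_sum => y _; rewrite ler_wpM2l. Qed.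

Lemma kapp_cst K (c : R) x : simplex (K x) -> kapp K (fun=> c) x = c.
Proof. by move=> [_ K1]; rewrite /kapp -mulr_suml K1 mul1r. Qed.

Lemma kappD K f g x : kapp K (fun y => f y + g y) x = kapp K f x + kapp K g x.
Proof. by rewrite /kapp -big_split; apply: eq_bigr => y _; rewrite mulrDr. Qed.

Lemma kappZ K (a : R) f x : kapp K (fun y => a * f y) x = a * kapp K f x.
Proof. by rewrite /kapp mulr_sumr; apply: eq_bigr => y _; rewrite mulrCA. Qed.

Lemma kappB K f g x : kapp K (fun y => f y - g y) x = kapp K f x - kapp K g x.
Proof. by rewrite /kapp -sumrB; apply: eq_bigr => y _; rewrite mulrBr. Qed.

Lemma finfun_bounded f : exists2 B : R, 0 <= B & forall x, `|f x| <= B.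
Proof.
exists (\sum_x `|f x|); first by rewrite sumr_ge0.
by move=> x; rewrite (bigD1 x)//= lerDl sumr_ge0.
Qed.

(** Minimum principle: at a minimizer [m] of [f] the mean of [f] is at least [f m], so the
    hypothesis gives a * f m <= f m, and a < 1 forces [f m] to be nonnegative. *)
Lemma ge0_comparison K (a : R) f : 0 <= a < 1 -> (forall x, simplex (K x)) ->
  (forall x, a * kapp K f x <= f x) -> forall x, 0 <= f x.
Proof.
move=> /andP[a0 a1] KP fK x.
have [m _ mP] := @arg_minP _ R T x xpredT f isT.
apply: le_trans (mP x isT); have := fK m.
have : f m <= kapp K f m.
  by rewrite -{1}(kapp_cst (f m) (KP m)); apply: kapp_le => // y; exact: mP.
nra.
Qed.

Lemma le_comparison K (a : R) (c f g : T -> R) : 0 <= a < 1 ->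
  (forall x, simplex (K x)) ->
  (forall x, f x <= c x + a * kapp K f x) ->
  (forall x, c x + a * kapp K g x <= g x) -> forall x, f x <= g x.
Proof.
move=> a01 KP fK gK x; rewrite -subr_ge0.
apply: (ge0_comparison (f := fun x => g x - f x) a01 KP) => y.
by rewrite kappB; have := fK y; have := gK y; lra.
Qed.

(** [Q] is the normalized resolvent, the matrix (1 - a) (I - a K)^-1. Comparison yields the
    invertibility of I - a K, the nonnegativity of [Q] and its row sums. *)
Lemma resolvent_exists K (a : R) : 0 <= a < 1 -> (forall x, simplex (K x)) ->
  exists Q : T -> T -> R, [/\ forall x, simplex (Q x),
    forall x y, Q x y = (1 - a) * (x == y)%:R + a * \sum_z Q x z * K z y &
    forall f x, kapp Q f x = (1 - a) * f x + a * kapp K (kapp Q f) x].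
Proof.
move=> a01 KP; have /andP[a0 a1] := a01.
pose n := #|T|.
pose KM : 'M[R]_n := \matrix_(i, j) K (enum_val i) (enum_val j).
pose A := 1%:M - a *: KM.
have sumE (F : T -> R) : \sum_(i < n) F (enum_val i) = \sum_x F x.
  by rewrite [RHS](reindex (@enum_val T xpredT)) //=; exact/onW_bij/enum_val_bij.
have sum_delta (i : 'I_n) (F : 'I_n -> R) : \sum_j F j * (i == j)%:R = F i.
  rewrite (bigD1 i)//= eqxx mulr1 big1 ?addr0// => j /negbTE.
  by rewrite eq_sym => ->; rewrite mulr0.
have Au : A \in unitmx.
  (* A row vector killed by the transpose is a function with f = a K f; comparison applied to f and
     to - f shows that it vanishes. *)
  rewrite -unitmx_tr -row_free_unit; apply: inj_row_free => v vA.
  pose f x := v 0 (enum_rank x).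
  have fE x : f x = a * kapp K f x.
    apply/eqP; rewrite -subr_eq0; apply/eqP.
    transitivity ((v *m A^T) 0 (enum_rank x)); last by rewrite vA mxE.
    rewrite !mxE /kapp -sumE mulr_sumr -[X in X - _](sum_delta _ (v 0)) -sumrB.
    apply: eq_bigr => j _; rewrite !mxE enum_rankK /f enum_valK; ring.
  apply/rowP => i; rewrite mxE -[i]enum_valK -/(f _); apply/eqP.
  rewrite eq_le -oppr_ge0 (ge0_comparison (f := fun x => - f x) a01 KP) => [|x].
    by apply: (ge0_comparison (f := f) a01 KP) => x; rewrite -fE.
  rewrite [X in _ <= - X]fE -mulrN /kapp -sumrN.
  by under [X in _ <= _ * X]eq_bigr => y _ do rewrite -mulrN.
pose Q x y : R := (1 - a) * invmx A (enum_rank x) (enum_rank y).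
(* The left inverse gives the identity that makes the limit of the resolvents invariant; the right
   inverse gives the equation for [kapp Q f]. *)
have leftE x y : Q x y = (1 - a) * (x == y)%:R + a * \sum_z Q x z * K z y.
  have /matrixP/(_ (enum_rank x) (enum_rank y)) := mulVmx Au.
  rewrite !mxE (inj_eq enum_rank_inj) /Q => <-.
  rewrite -[X in _ * X = _](sum_delta (enum_rank y)).
  rewrite -(sumE (fun z => _ * K z y)) !mulr_sumr -big_split/=.
  apply: eq_bigr => j _; rewrite !mxE enum_valK enum_rankK eq_sym; ring.
have rightE x y : Q x y = (1 - a) * (x == y)%:R + a * \sum_z K x z * Q z y.
  have /matrixP/(_ (enum_rank x) (enum_rank y)) := mulmxV Au.
  rewrite !mxE (inj_eq enum_rank_inj) /Q => <-.
  rewrite -[X in _ * X = _](sum_delta (enum_rank x) ((invmx A)^~ _)).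
  rewrite -(sumE (fun z => K x z * _)) !mulr_sumr -big_split/=.
  apply: eq_bigr => j _; rewrite !mxE enum_valK enum_rankK; ring.
have appE f x : kapp Q f x = (1 - a) * f x + a * kapp K (kapp Q f) x.
  have -> : f x = \sum_y (x == y)%:R * f y.
    rewrite (bigD1 x)//= eqxx mul1r big1 ?addr0// => y /negbTE.
    by rewrite eq_sym => ->; rewrite mul0r.
  rewrite /kapp; under [X in a * X]eq_bigr => z _ do rewrite mulr_sumr.
  rewrite exchange_big !mulr_sumr -big_split/=; apply: eq_bigr => y _.
  rewrite {1}rightE mulrDl -!mulrA; congr (_ + _ * _); rewrite mulr_suml.
  by apply: eq_bigr => z _; rewrite mulrA.
exists Q; split => //.
move=> x; split.
  (* Column [y] of [Q] is the resolvent applied to the indicator of [y], to which the minimum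
     principle applies. *)
  move=> y; pose e z : R := (z == y)%:R.
  have QeE z : kapp Q e z = Q z y.
    by rewrite /kapp (bigD1 y)//= /e eqxx mulr1 big1 ?addr0// => t /negbTE ->; rewrite mulr0.
  rewrite -QeE; apply: (ge0_comparison a01 KP) => z.
  by rewrite appE lerDr mulr_ge0 ?ler0n// subr_ge0 ltW.
have -> : \sum_y Q x y = kapp Q (fun=> 1) x by apply: eq_bigr => y _; rewrite mulr1.
apply/eqP; rewrite eq_le; apply/andP; split.
  apply: (le_comparison (c := fun=> 1 - a) (g := fun=> 1) a01 KP) => y.
    by rewrite appE mulr1.
  by rewrite kapp_cst//; lra.
apply: (le_comparison (c := fun=> 1 - a) (f := fun=> 1) a01 KP) => y.
  by rewrite kapp_cst//; lra.
by rewrite appE mulr1.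
Qed.

End kernels.

(** * Limits along ultrafilters and optimal discounted kernels *)

Section ultrafilters.
Context (I : Type) (F : set_system I) {FU : UltraFilter F}.

Lemma fmap_ultra (U : Type) (f : I -> U) : UltraFilter (f @ F).
Proof.
split=> [|G GF FG]; first exact: fmap_proper_filter.
apply/seteqP; split => // A GA.
have [//|FA] := in_ultra_setVsetC (f @^-1` A) FU.
have /FG GA' : (f @ F) (~` A) by [].
by have [x []] := filter_ex (filterI GA GA').
Qed.

Lemma ultra_bounded_cvg (R : realType) (f : I -> R) (C : R) :
  (\forall i \near F, `|f i| <= C) -> exists l : R, f i @[i --> F] --> l.
Proof.
move=> fC; have := @segment_compact R (- C) C.
rewrite compact_ultra => /(_ (f @ F) (fmap_ultra f)) [|l [_ fl]]; last by exists l.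
by apply: filterS fC => i /=; rewrite in_itv/= ler_norml.
Qed.

Lemma ultra_family_cvg (R : realType) (J : Type) (f : J -> I -> R) (C : R) :
  (\forall i \near F, forall j, `|f j i| <= C) ->
  exists l : J -> R, forall j, f j i @[i --> F] --> l j.
Proof.
move=> fC; have H j : exists l : R, f j i @[i --> F] --> l.
  by apply: (@ultra_bounded_cvg _ _ C); apply: filterS fC.
by have [l] := choice H; exists l.
Qed.

End ultrafilters.

Section limits.
Context (R : realType) (I : Type) (F : set_system I) {FF : ProperFilter F}.

Lemma cvg_eq_lim (f g : I -> R) (a b : R) : f i @[i --> F] --> a ->
  g i @[i --> F] --> b -> (\forall i \near F, f i = g i) -> a = b.
Proof.
move=> fa gb fg; apply: (cvg_unique (@Rhausdorff R) fa).
by apply: (cvg_trans _ gb); apply: near_eq_cvg; apply: filterS fg => i ->.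
Qed.

Lemma cvg_le_lim (f g : I -> R) (a b : R) : f i @[i --> F] --> a ->
  g i @[i --> F] --> b -> (\forall i \near F, f i <= g i) -> a <= b.
Proof.
move=> fa gb fg; rewrite -subr_ge0.
apply: (@cvgr_to_ge _ F _ _ (fun i => g i - f i) (b - a)); first exact: (cvgB gb fa).
by apply: filterS fg => i; rewrite subr_ge0.
Qed.

Lemma cvg_finsum (T : finType) (P : pred T) (f : T -> I -> R) (l : T -> R) :
  (forall x, f x i @[i --> F] --> l x) ->
  \sum_(x | P x) f x i @[i --> F] --> \sum_(x | P x) l x.
Proof.
move=> fl; elim: (index_enum T) => [|x s IH].
  by rewrite big_nil; under eq_fun do rewrite big_nil; exact: cvg_cst.
rewrite big_cons; under eq_fun do rewrite big_cons.
by case: ifP => // _; apply: cvgD.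
Qed.

Lemma cvg_kapp (T : finType) (k : I -> T -> T -> R) (K : T -> T -> R)
    (f : I -> T -> R) (g : T -> R) (x : T) :
  (forall y, k i x y @[i --> F] --> K x y) ->
  (forall y, f i y @[i --> F] --> g y) ->
  kapp (k i) (f i) x @[i --> F] --> kapp K g x.
Proof. by move=> kK fg; apply: cvg_finsum => y; apply: cvgM. Qed.

Lemma near_forall_fin (T : finType) (P : T -> I -> Prop) :
  (forall x, \forall i \near F, P x i) -> \forall i \near F, forall x, P x i.
Proof.
move=> FP; have : \forall i \near F, forall x, x \in enum T -> P x i.
  elim: (enum T) => [|x s IH]; first by apply: nearW.
  apply: filterS2 (FP x) IH => i Px Ps y; rewrite inE => /orP[/eqP->//|]; exact: Ps.
by apply: filterS => i H x; apply: H; rewrite mem_enum.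
Qed.

End limits.

(** Compactness for entrywise convergence. The index type is arbitrary because both sequences of
    kernels and families indexed by the discount factor are used. *)
Definition ultraclosed (R : realType) (T : finType)
    (KK : set (T -> T -> R)) :=
  forall (I : Type) (F : set_system I) (k : I -> T -> T -> R), UltraFilter F ->
    (\forall i \near F, KK (k i)) ->
    exists2 K : T -> T -> R, KK K & forall x y, k i x y @[i --> F] --> K x y.

(** Rectangularity in the form of gluing: it serves to change a single row of a kernel, and to
    switch between two kernels on a set of states. *)
Definition decomposable (R : realType) (T : finType)
    (KK : set (T -> T -> R)) :=
  forall (K L : T -> T -> R) (B : pred T), KK K -> KK L ->
    KK (fun x => if B x then K x else L x).

(** * Optimal kernels for a fixed discount factor *)

Section discounted.
Context (R : realType) (T : finType) (c : T -> T -> R).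
Implicit Types (K L : T -> T -> R) (v : T -> R) (a : R).

Definition mean_cost K (x : T) := kapp K (c x) x.

(** The solution is the expected discounted cost multiplied by 1 - a, as a function of the initial
    state. *)
Definition is_value a K v :=
  forall x, v x = (1 - a) * mean_cost K x + a * kapp K v x.

Lemma value_exists a K : 0 <= a < 1 -> (forall x, simplex (K x)) ->
  exists v, is_value a K v.
Proof.
move=> a01 KP; have [Q [_ _ QE]] := resolvent_exists a01 KP.
by exists (kapp Q (mean_cost K)) => x; exact: QE.
Qed.

Lemma value_le a L v w : 0 <= a < 1 -> (forall x, simplex (L x)) ->
  (forall x, v x <= (1 - a) * mean_cost L x + a * kapp L v x) ->
  is_value a L w -> forall x, v x <= w x.
Proof.
move=> a01 LP vL wL; apply: (le_comparison a01 LP vL) => x.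
by rewrite [leRHS]wL.
Qed.

Lemma value_ge a L v w : 0 <= a < 1 -> (forall x, simplex (L x)) ->
  (forall x, (1 - a) * mean_cost L x + a * kapp L v x <= v x) ->
  is_value a L w -> forall x, w x <= v x.
Proof.
move=> a01 LP vL wL; apply: (le_comparison a01 LP _ vL) => x.
by rewrite [leLHS]wL.
Qed.

Lemma mean_cost_bounded K C x : simplex (K x) ->
  (forall y, `|c x y| <= C) -> `|mean_cost K x| <= C.
Proof.
move=> Kx cC; have cC' y : - C <= c x y <= C by rewrite -ler_norml.
rewrite ler_norml; apply/andP; split.
  by rewrite -(kapp_cst (- C) Kx); apply: kapp_le => // y; case/andP: (cC' y).
by rewrite -[leRHS](kapp_cst C Kx); apply: kapp_le => // y; case/andP: (cC' y).
Qed.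

(** The constants - C and C are a subsolution and a supersolution. The bound is uniform in [a],
    which lets the values converge along ultrafilters. *)
Lemma value_bounded a K v C : 0 <= a < 1 -> (forall x, simplex (K x)) ->
  (forall x y, `|c x y| <= C) -> is_value a K v -> forall x, `|v x| <= C.
Proof.
move=> a01 KP cC vK x; have /andP[a0 a1] := a01.
have rC y : - C <= mean_cost K y <= C.
  by rewrite -ler_norml; exact: mean_cost_bounded.
rewrite ler_norml; apply/andP; split.
  apply: (value_le (L := K) (v := fun=> - C) a01 KP _ vK) => y.
  by rewrite kapp_cst//; have := rC y; nra.
apply: (value_ge (L := K) (v := fun=> C) a01 KP _ vK) => y.
by rewrite kapp_cst//; have := rC y; nra.
Qed.

Context (KK : set (T -> T -> R)).
Hypothesis KKst : forall K, KK K -> forall x, simplex (K x).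
Hypothesis KKmix : decomposable KK.
Hypothesis KKultra : ultraclosed KK.
Hypothesis KKne : KK !=set0.

(** By compactness some kernel minimizes the sum of the values over all states. Its value satisfies
    the optimality inequality at every state, since otherwise the change of one row would lower the
    sum. *)
Lemma optimal_exists a : 0 <= a < 1 -> exists K v, [/\ KK K, is_value a K v &
  forall L, KK L -> forall x, v x <= (1 - a) * mean_cost L x + a * kapp L v x].
Proof.
move=> a01; have /andP[a0 a1] := a01.
have [C cC] : exists C : R, forall x y, `|c x y| <= C.
  have [C _ cC] := finfun_bounded (fun z : T * T => c z.1 z.2).
  by exists C => x y; exact: (cC (x, y)).
pose S := [set s | exists K v, [/\ KK K, is_value a K v & s = \sum_x v x]].
have Slb : has_inf S.
  split.
    have [K KKK] := KKne; have [v vK] := value_exists a01 (KKst KKK).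
    by exists (\sum_x v x), K, v.
  exists (\sum_(x : T) - C) => s [K [v [KKK vK ->]]].
  apply: ler_sum => x _; have := value_bounded a01 (KKst KKK) cC vK x.
  by rewrite ler_norml => /andP[].
have H n : exists Kv : (T -> T -> R) * (T -> R),
    [/\ KK Kv.1, is_value a Kv.1 Kv.2 & \sum_x Kv.2 x < inf S + n.+1%:R^-1].
  have n0 : 0 < n.+1%:R^-1 :> R by rewrite invr_gt0 ltr0Sn.
  have [s [K [v [KKK vK ->]]] slt] := inf_adherent n0 Slb.
  by exists (K, v).
have [kv kvP] := choice H.
(* Along this ultrafilter the minimizing kernels and their values converge, and the limit attains
   the infimum. *)
have [F [FU FF]] := ultraFilterLemma (eventually_filter : ProperFilter \oo).
have [K KKK Kcvg] : exists2 K : T -> T -> R, KK K & forall x y, (kv n).1 x y @[n --> F] --> K x y.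
  by apply: KKultra; apply: nearW => n; have [] := kvP n.
have [v vcvg] : exists v : T -> R, forall x, (kv n).2 x @[n --> F] --> v x.
  apply: (@ultra_family_cvg _ _ _ _ _ (fun x n => (kv n).2 x) C).
  apply: nearW => n x; have [Kn vn _] := kvP n.
  exact: value_bounded a01 (KKst Kn) cC vn x.
have vK : is_value a K v.
  move=> x; apply: (cvg_eq_lim (F := F) (g := fun n =>
    (1 - a) * mean_cost (kv n).1 x + a * kapp (kv n).1 (kv n).2 x) (vcvg x)); last first.
    by apply: nearW => n; have [_ /(_ x) + _] := kvP n.
  apply: cvgD.
    apply: (cvgM (cvg_cst _)); apply: cvg_kapp => // y; exact: cvg_cst.
  by apply: (cvgM (cvg_cst _)); exact: cvg_kapp.
have vinf : \sum_x v x = inf S.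
  apply/eqP; rewrite eq_le; apply/andP; split; last first.
    by apply: ge_inf; [case: Slb|exists K, v].
  apply: (cvg_le_lim (F := F)); first by apply: cvg_finsum; exact: vcvg.
    have : (inf S + n.+1%:R^-1) @[n --> \oo] --> inf S + 0.
      by apply: cvgD; [exact: cvg_cst|exact: cvg_harmonic].
    by rewrite addr0 => SS; apply: (cvg_trans _ SS); apply: cvg_app; exact: FF.
  by apply: nearW => n; have [_ _ /ltW] := kvP n.
exists K, v; split => // L KKL x; rewrite leNgt; apply/negP => lt.
(* With the single row [x] taken from [L], the value drops strictly at [x] and rises nowhere. *)
pose K' y := if y == x then L y else K y.
have KKK' : KK K' by apply: KKmix.
have [w wK'] := value_exists a01 (KKst KKK').
have wv y : w y <= v y.
  apply: (value_ge (L := K') a01 (KKst KKK') _ wK') => z.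
  rewrite /mean_cost /kapp /K'; case: eqP => [->|_]; first exact: ltW.
  by rewrite [leRHS]vK.
have wvx : w x < v x.
  apply: le_lt_trans lt; rewrite wK' /mean_cost /kapp /K' eqxx.
  rewrite lerD2l ler_wpM2l//; apply: ler_sum => y _; rewrite ler_wpM2l//.
  by have [+ _] := KKst KKL x.
have : \sum_y v y <= \sum_y w y.
  by rewrite vinf; apply: ge_inf; [case: Slb|exists K', w].
rewrite leNgt => /negP; apply; rewrite [ltLHS](bigD1 x)// [ltRHS](bigD1 x)//=.
by rewrite ltr_leD// ler_sum.
Qed.

End discounted.

(** * A kernel that is nearly optimal for the average cost *)

Lemma kapp_comp (R : realType) (T : finType) (K L : T -> T -> R) f x :
  kapp K (kapp L f) x = kapp (fun x y => \sum_z K x z * L z y) f x.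
Proof.
rewrite /kapp; under eq_bigr => y _ do rewrite mulr_sumr.
rewrite exchange_big; apply: eq_bigr => y _; rewrite mulr_suml.
by apply: eq_bigr => z _; rewrite mulrA.
Qed.

Lemma kapp_eq0 (R : realType) (T : finType) (K : T -> T -> R) (f : T -> R) x :
  simplex (K x) -> (forall y, 0 <= f y) -> kapp K f x <= 0 ->
  forall y, K x y * f y = 0.
Proof.
move=> [K0 _] f0 Kf y; have Kf0 z : 0 <= K x z * f z by rewrite mulr_ge0.
apply/eqP; rewrite eq_le Kf0 andbT; apply: le_trans Kf.
by rewrite /kapp (bigD1 y)//= lerDl sumr_ge0.
Qed.

Section certificate.
Context (R : realType) (T : finType) (c : T -> T -> R).
Context (KK : set (T -> T -> R)).
Hypothesis KKst : forall K, KK K -> forall x, simplex (K x).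
Hypothesis KKmix : decomposable KK.
Hypothesis KKultra : ultraclosed KK.
Context (F : set_system R) {FU : UltraFilter F} (F1 : (1 : R)^'- `<=` F).

Let near01 : \forall a \near F, 0 < a < 1.
Proof.
apply: F1; near=> a; apply/andP; split; last by near: a; exact: nbhs_left_lt.
by near: a; apply: nbhs_left_gt; exact: ltr01.
Unshelve. all: by end_near. Qed.

Let id_cvg : a @[a --> F] --> (1 : R).
Proof. by apply: (cvg_trans (cvg_app _ F1)); exact: cvg_at_left_filter. Qed.

Let onem_cvg : 1 - a @[a --> F] --> (0 : R).
Proof. by rewrite -(subrr (1 : R)); apply: cvgB; [exact: cvg_cst|exact: id_cvg]. Qed.

(** As [a] tends to 1 the cost term of the value equation disappears, and only harmonicity is
    left. *)
Let fixed_point_lim (k : R -> T -> T -> R) (K : T -> T -> R)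
    (f r_ : R -> T -> R) (g r : T -> R) x :
  (forall y, k a x y @[a --> F] --> K x y) ->
  (forall y, f a y @[a --> F] --> g y) -> r_ a x @[a --> F] --> r x ->
  (1 - a) * r_ a x + a * kapp (k a) (f a) x @[a --> F] --> kapp K g x.
Proof.
move=> kK fg rr.
have : (1 - a) * r_ a x + a * kapp (k a) (f a) x @[a --> F] -->
    0 * r x + 1 * kapp K g x.
  by apply: cvgD; [apply: cvgM|apply: cvgM; [exact: id_cvg|exact: cvg_kapp]].
by rewrite mul0r add0r mul1r.
Qed.

Context (k : R -> T -> T -> R) (v_ : R -> T -> R) (v : T -> R).
Hypothesis kKK : forall a, 0 < a < 1 -> KK (k a).
Hypothesis v_value : forall a, 0 < a < 1 -> is_value c a (k a) (v_ a).
Hypothesis v_optimal : forall a L x, 0 < a < 1 -> KK L ->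
  v_ a x <= (1 - a) * mean_cost c L x + a * kapp L (v_ a) x.
Hypothesis v_cvg : forall x, v_ a x @[a --> F] --> v x.

Let w01 (a : R) : 0 < a < 1 -> 0 <= a < 1.
Proof. by move=> /andP[/ltW -> ->]. Qed.

(* G collects the states where the discounted values of the limit kernel K0
   converge to v as well. The new kernel is K0 on G, which is closed for K0, and
   k a off G, for a close to 1. *)
Lemma gain_certificate (e : R) : 0 < e -> exists K f h, [/\ KK K,
  forall x, kapp K f x <= f x,
  forall x, mean_cost c K x + kapp K h x <= h x + f x + e &
  forall x, f x <= v x + e].
Proof.
move=> e0.
have [C cC] : exists C : R, forall x y, `|c x y| <= C.
  have [C _ cC] := finfun_bounded (fun z : T * T => c z.1 z.2).
  by exists C => x y; exact: (cC (x, y)).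
have [K0 KKK0 K0cvg] : exists2 K, KK K & forall x y, k a x y @[a --> F] --> (K x y : R).
  by apply: KKultra; apply: filterS near01 => a; exact: kKK.
have K0st := KKst KKK0.
pose r := mean_cost c K0.
have rcvg x : mean_cost c (k a) x @[a --> F] --> r x.
  by apply: cvg_kapp => // y; exact: cvg_cst.
(* For [a] outside ]0, 1[ the choice is arbitrary: [F] contains this interval, so no limit along [F]
   depends on it. *)
have /choice[Q_ Q_P] : forall a : R, exists Q_ : T -> T -> R, 0 < a < 1 ->
    [/\ forall x, simplex (Q_ x),
    forall x y, Q_ x y = (1 - a) * (x == y)%:R + a * \sum_z Q_ x z * k a z y &
    forall f x, kapp Q_ f x = (1 - a) * f x + a * kapp (k a) (kapp Q_ f) x].
  move=> a; have [a01|na] := pselect (0 < a < 1 : Prop); last by exists (k a).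
  by have [Q QP] := resolvent_exists (w01 a01) (KKst (kKK a01)); exists Q.
have /choice[g_ g_P] : forall a : R, exists g_ : T -> R, 0 < a < 1 -> is_value c a K0 g_.
  move=> a; have [a01|na] := pselect (0 < a < 1 : Prop); last by exists v.
  by have [g gP] := value_exists c (w01 a01) K0st; exists g.
have [Q Qcvg] : exists Q : T * T -> R, forall z, Q_ a z.1 z.2 @[a --> F] --> Q z.
  apply: (@ultra_family_cvg _ _ _ _ _ (fun z a => Q_ a z.1 z.2) 1).
  apply: filterS near01 => a a01 [x y] /=; have [/(_ x)[Q0 Q1] _ _] := Q_P a a01.
  by rewrite ger0_norm// -Q1 (bigD1 y)//= lerDl sumr_ge0.
pose QQ x y := Q (x, y).
have QQcvg x y : Q_ a x y @[a --> F] --> QQ x y by exact: (Qcvg (x, y)).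
have [g gcvg] : exists g : T -> R, forall x, g_ a x @[a --> F] --> g x.
  apply: (@ultra_family_cvg _ _ _ _ _ (fun x a => g_ a x) C).
  apply: filterS near01 => a a01 x.
  by apply: (value_bounded (w01 a01) K0st cC (g_P a a01)).
have QQst x : simplex (QQ x).
  split.
    move=> y; apply: (cvgr_to_ge (QQcvg x y)).
    by apply: filterS near01 => a /Q_P[/(_ x)[]].
  apply: (cvg_eq_lim (F := F) (f := fun a => \sum_y Q_ a x y) (g := fun=> 1)).
  - exact: cvg_finsum.
  - exact: cvg_cst.
  - by apply: filterS near01 => a /Q_P[/(_ x)[]].
(* In the limit the left resolvent identity loses its diagonal term, so the rows of [QQ] are
   invariant under [K0]. *)
have QK x y : QQ x y = \sum_z QQ x z * K0 z y.
  apply: (cvg_eq_lim (F := F) (QQcvg x y)); last first.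
    by apply: filterS near01 => a /Q_P[_ + _]; apply.
  have : (1 - a) * (x == y)%:R + a * (\sum_z Q_ a x z * k a z y) @[a --> F] -->
      0 * (x == y)%:R + 1 * \sum_z QQ x z * K0 z y.
    apply: cvgD; apply: cvgM; [exact: onem_cvg|exact: cvg_cst|exact: id_cvg|].
    by apply: cvg_finsum => z; exact: cvgM.
  by rewrite mul0r add0r mul1r.
(* Before the limit, [v_ a] and the resolvent of the mean cost solve the same value equation, hence
   agree. *)
have vQr x : v x = kapp QQ r x.
  apply: (cvg_eq_lim (F := F) (@v_cvg x) (cvg_kapp (k := Q_)
    (f := fun a => mean_cost c (k a)) (QQcvg x) rcvg)).
  apply: filterS near01 => a a01; have [_ _ QE] := Q_P a a01.
  have Qv : is_value c a (k a) (kapp (Q_ a) (mean_cost c (k a))) by move=> y; exact: QE.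
  apply/eqP; rewrite eq_le; apply/andP; split.
    by apply: (value_le (w01 a01) (KKst (kKK a01)) _ Qv) => y; rewrite -v_value.
  by apply: (value_ge (w01 a01) (KKst (kKK a01)) _ Qv) => y; rewrite -v_value.
(* Integrating the value equation of [K0] against the invariant rows of [QQ] gives Q g_a = (1 - a) v
   + a Q g_a, and 1 - a cancels. *)
have Qg_ a x : 0 < a < 1 -> kapp QQ (g_ a) x = v x.
  move=> a01; have : kapp QQ (g_ a) x = (1 - a) * v x + a * kapp QQ (g_ a) x.
    rewrite [X in a * X](_ : _ = kapp QQ (kapp K0 (g_ a)) x); last first.
      by rewrite kapp_comp; apply: eq_bigr => y _; rewrite -QK.
    rewrite vQr -!kappZ -kappD; apply: eq_bigr => y _.
    by congr (_ * _); exact: g_P.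
  move: a01 => /andP[a0 a1] E; apply: (@mulfI _ (1 - a)); first by rewrite subr_eq0 gt_eqF.
  by lra.
have Qg x : kapp QQ g x = v x.
  apply: (cvg_eq_lim (F := F) (f := fun a => kapp QQ (g_ a) x) (g := fun=> v x)).
  - by apply: cvg_kapp => // y; exact: cvg_cst.
  - exact: cvg_cst.
  - by apply: filterS near01 => a; exact: Qg_.
have vL L x : KK L -> v x <= kapp L v x.
  move=> KKL; apply: (cvg_le_lim (F := F) (@v_cvg x)); last first.
    by apply: filterS near01 => a a01; exact: v_optimal a01 KKL.
  apply: (fixed_point_lim (k := fun=> L) (r_ := fun=> mean_cost c L)
    (r := mean_cost c L)) => // [y|]; exact: cvg_cst.
(* By [vL], [v] is a subsolution of the equation w = (1 - a) v + a k_a w, whose solution is Q_a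
   v. *)
have vQ_ a x : 0 < a < 1 -> v x <= kapp (Q_ a) v x.
  move=> a01; have [Qst _ QE] := Q_P a a01; have KKk := kKK a01.
  apply: (le_comparison (c := fun x => (1 - a) * v x) (w01 a01) (KKst KKk)) => y.
    by have /andP[a0 a1] := a01; have := vL _ y KKk; nra.
  by rewrite [leRHS]QE.
have Q_cvg f x : kapp (Q_ a) f x @[a --> F] --> kapp QQ f x.
  by apply: cvg_kapp => // y; exact: cvg_cst.
have vQ x : v x <= kapp QQ v x.
  apply: (cvg_le_lim (F := F) (f := fun=> v x) _ (Q_cvg v x)); first exact: cvg_cst.
  by apply: filterS near01 => a a01; exact: vQ_.
have vg x : v x <= g x.
  apply: (cvg_le_lim (F := F) (@v_cvg x) (gcvg x)).
  apply: filterS near01 => a a01.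
  by apply: (value_le (w01 a01) K0st _ (g_P a a01)) => y; exact: v_optimal.
have gK x : g x = kapp K0 g x.
  apply: (cvg_eq_lim (F := F) (gcvg x)); last first.
    by apply: filterS near01 => a a01; exact: g_P a01 x.
  apply: (fixed_point_lim (k := fun=> K0) (r_ := fun=> mean_cost c K0)
    (r := mean_cost c K0)) => // [y|]; exact: cvg_cst.
pose G x := g x == v x.
have gv0 x : 0 <= g x - v x by rewrite subr_ge0.
(* The nonnegative function g - v has mean v - Q v <= 0 under [QQ], so it vanishes wherever [QQ]
   puts mass. *)
have QG x y : ~~ G y -> QQ x y = 0.
  move=> nGy; have /eqP : QQ x y * (g y - v y) = 0.
    by apply: (kapp_eq0 (f := fun y => g y - v y)) => //; rewrite kappB Qg subr_le0.
  by rewrite mulf_eq0 subr_eq0 -/(G y) (negbTE nGy) orbF => /eqP.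
(* From a state of [G], the mean of g - v under [K0] is v - K0 v <= 0, so the chain cannot leave
   [G]. *)
have K0G x y : G x -> ~~ G y -> K0 x y = 0.
  move=> /eqP Gx nGy; have /eqP : K0 x y * (g y - v y) = 0.
    apply: (kapp_eq0 (f := fun y => g y - v y)) => //.
    by rewrite kappB subr_le0 -gK Gx vL.
  by rewrite mulf_eq0 subr_eq0 -/(G y) (negbTE nGy) orbF => /eqP.
have Qv x : kapp QQ v x = v x.
  apply/eqP; rewrite eq_le vQ andbT -[leRHS]Qg; exact: kapp_le.
pose oneG x : R := (G x)%:R.
have QoneG x : kapp QQ oneG x = 1.
  have [_ <-] := QQst x; apply: eq_bigr => y _; rewrite /oneG.
  by have [|/QG ->] := boolP (G y); rewrite ?mulr1 ?mul0r.
(* The bound 1 / 4 leaves a strict decrease of [f] off [G]; the bound e / 2 makes the two losses in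
   [f], from [w] and from [z], at most [e] together. *)
pose eta := Num.min (1 / 4) (e / 2).
have eta0 : 0 < eta by rewrite lt_min; apply/andP; split; lra.
have [eta1 eta2] : eta <= 1 / 4 /\ eta <= e / 2.
  by split; rewrite ge_min lexx ?orbT.
have nearv : \forall a \near F, forall x, kapp (Q_ a) v x <= v x + eta.
  apply: near_forall_fin => x; have := Q_cvg v x; rewrite Qv => /cvgr_le; apply.
  by rewrite ltrDl.
have nearG : \forall a \near F, forall x, 1 - eta <= kapp (Q_ a) oneG x.
  apply: near_forall_fin => x; have := Q_cvg oneG x; rewrite QoneG => /cvgr_ge; apply.
  by rewrite ltrBlDr ltrDl.
have nearg : \forall a \near F, forall x, g_ a x <= g x + e.
  by apply: near_forall_fin => x; apply: (cvgr_le _ (gcvg x)); rewrite ltrDl.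
have [a [[a01 va] [Ga ga]]] :=
  filter_ex (filterI (filterI near01 nearv) (filterI nearG nearg)).
have /andP[a0 a1] := a01; have [Qst _ QE] := Q_P a a01.
have KKk := kKK a01.
(* For the chain [k a] stopped at an independent geometric time, [w] is the mean of [v] at that time
   and [z] the probability of being outside [G]; both w - v and [z] are at most [eta]. *)
pose w := kapp (Q_ a) v.
pose z x := 1 - kapp (Q_ a) oneG x.
have z0 x : 0 <= z x.
  rewrite subr_ge0 -(kapp_cst 1 (Qst x)); apply: kapp_le => // y.
  by rewrite /oneG lern1 leq_b1.
have wv x : v x <= w x by exact: vQ_.
have wE x : w x = (1 - a) * v x + a * kapp (k a) w x by exact: QE.
have zE x : ~~ G x -> a * kapp (k a) z x = z x - (1 - a).
  move=> nGx; rewrite /z kappB kapp_cst; last exact: (KKst KKk).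
  have := QE oneG x; rewrite {2}/oneG (negbTE nGx) mulr0 add0r; lra.
pose K x := if G x then K0 x else k a x.
pose f x := if G x then v x else w x + z x.
have KKK : KK K by exact: KKmix.
have fwz x : f x <= w x + z x by rewrite /f; case: ifP => // _; have := wv x; have := z0 x; lra.
(* Off [G] one has a (w + z - k_a (w + z)) = (1 - a) (1 - (w - v) - z), which is at least (1 - a) /
   2 since w - v and [z] are at most 1 / 4. *)
pose d := (1 - a) / 2.
have d0 : 0 < d by rewrite /d; lra.
have fG x : G x -> kapp K f x = f x.
  move=> Gx; rewrite /kapp /K Gx {2}/f Gx -(eqP Gx : g x = v x) gK.
  apply: eq_bigr => y _; rewrite /f; have [Gy|/(K0G _ _ Gx) ->] := boolP (G y).
    by rewrite (eqP Gy : g y = v y).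
  by rewrite !mul0r.
have fnG x : ~~ G x -> kapp K f x <= f x - d.
  move=> nGx; rewrite {1}/kapp /K (negbTE nGx) -/(kapp (k a) f x).
  have H1 : kapp (k a) f x <= kapp (k a) w x + kapp (k a) z x.
    by rewrite -kappD; apply: kapp_le => //; exact: KKst KKk x.
  have H2 : z x <= 1 / 4 by have := Ga x; rewrite /z; lra.
  have H3 : w x - v x <= 1 / 4 by have := va x; rewrite -/(w x); lra.
  rewrite /f (negbTE nGx); apply: (le_trans H1); rewrite -(ler_pM2l a0).
  have H4 : (1 - a) * (w x - v x) <= (1 - a) * (1 / 4) by rewrite ler_wpM2l//; lra.
  have H5 : (1 - a) * z x <= (1 - a) * (1 / 4) by rewrite ler_wpM2l//; lra.
  have H6 : 0 <= (1 - a) * (1 - a) by rewrite mulr_ge0//; lra.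
  rewrite mulrDr (zE _ nGx) [_ * kapp _ w x](_ : _ = w x - (1 - a) * v x); last first.
    by have := wE x; lra.
  by rewrite /d; nra.
(* The unnormalized discounted value of [K0]: it satisfies r + K0 h0 = h0 + K0 g_a exactly, and g_a
   <= g + e with [g] harmonic for [K0]. *)
pose h0 x := (1 - a)^-1 * g_ a x.
have a1' : 1 - a != 0 by rewrite subr_eq0 gt_eqF.
have h0E x : r x + kapp K0 h0 x <= h0 x + g x + e.
  have := g_P a a01 x; rewrite -/r => E.
  have -> : r x = (1 - a)^-1 * (g_ a x - a * kapp K0 (g_ a) x).
    by rewrite E; field.
  rewrite /h0 kappZ -mulrDr.
  have H1 : kapp K0 (g_ a) x <= g x + e.
    rewrite gK -(kapp_cst e (K0st x)) -kappD; exact: kapp_le.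
  rewrite [leLHS](_ : _ = (1 - a)^-1 * g_ a x + kapp K0 (g_ a) x); last by field.
  by rewrite -addrA lerD2l.
(* The inequality may fail off [G] by at most [B]. Adding B / d times [f] repairs it there, because
   [K] lowers [f] by [d], and changes nothing on [G], where [f] is harmonic. *)
have [B B0 BP] := finfun_bounded (fun x => mean_cost c K x + kapp K h0 x - h0 x - f x).
pose h x := h0 x + (B / d) * f x.
exists K, f, h; split => //.
- by move=> x; have [/fG ->//|/fnG H] := boolP (G x); apply: (le_trans H); lra.
- move=> x; rewrite /h kappD kappZ; have [Gx|nGx] := boolP (G x).
    rewrite fG// addrA -!addrA; have := h0E x; rewrite /r /mean_cost /kapp /K Gx /f Gx.
    by rewrite (eqP Gx : g x = v x); lra.
  have Bd : 0 <= B / d by rewrite divr_ge0// ltW.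
  have H1 := ler_wpM2l Bd (fnG _ nGx); have := BP x; rewrite ler_norml => /andP[_].
  by move: H1; rewrite mulrBr divfK ?gt_eqF//; lra.
- move=> x; apply: (le_trans (fwz x)); have := va x; rewrite -/(w x) => H1.
  by have := Ga x; rewrite /z; lra.
Qed.

End certificate.

(** * Bounded random variables *)

Lemma bounded_sups (R : realType) (u : nat -> R) (C : R) :
  (forall n, `|u n| <= C) -> [/\ has_ubound (range u), has_lbound (range u),
    forall n, `|sups u n| <= C & sups u n @[n --> \oo] --> limn_sup u].
Proof.
move=> uC; have uC' n : - C <= u n <= C by rewrite -ler_norml.
have ub : has_ubound (range u) by exists C => _ [n _ <-]; case/andP: (uC' n).
have lb : has_lbound (range u) by exists (- C) => _ [n _ <-]; case/andP: (uC' n).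
split => //; last first.
  by have h := cvg_sups_inf ub lb; rewrite /limn_sup (cvg_lim _ h).
move=> n; rewrite ler_norml; apply/andP; split.
  apply: (@le_trans _ _ (u n)); first by case/andP: (uC' n).
  by apply: ub_le_sup; [exact: has_ubound_sdrop|exists n => /=].
apply: ge_sup; first by exists (u n), n => /=.
by move=> _ [m /= _ <-]; case/andP: (uC' m).
Qed.

Lemma limn_sup_le (R : realType) (u : nat -> R) (C b : R) :
  (forall n, `|u n| <= C) -> (exists N, forall n, (N <= n)%N -> u n <= b) ->
  limn_sup u <= b.
Proof.
move=> uC [N uN]; have [_ _ _ cvg_sups] := bounded_sups uC.
apply: (cvgr_to_le cvg_sups); exists N => // n Nn.
apply: ge_sup; first by exists (u n), n => /=.
by move=> _ [m /= nm <-]; apply: uN; exact: leq_trans nm.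
Qed.

Section bounded_random_variables.
Context (d : measure_display) (W : measurableType d) (R : realType).
Implicit Types (f g : W -> R) (P : probability W R).

Definition bounded_rv f :=
  measurable_fun [set: W] f /\ exists C : R, forall w, `|f w| <= C.

Lemma bounded_rv_cst (a : R) : bounded_rv (fun=> a).
Proof. by split; [exact: measurable_cst|exists `|a|]. Qed.

Lemma bounded_rvD f g : bounded_rv f -> bounded_rv g ->
  bounded_rv (fun w => f w + g w).
Proof.
move=> [mf [A fA]] [mg [B gB]]; split; first exact: measurable_funD.
by exists (A + B) => w; rewrite (le_trans (ler_normD _ _))// lerD.
Qed.

Lemma bounded_rvM f g : bounded_rv f -> bounded_rv g ->
  bounded_rv (fun w => f w * g w).
Proof.
move=> [mf [A fA]] [mg [B gB]]; split; first exact: measurable_funM.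
by exists (A * B) => w; rewrite normrM ler_pM.
Qed.

Lemma bounded_rvZ (a : R) f : bounded_rv f -> bounded_rv (fun w => a * f w).
Proof. by move=> bf; apply: bounded_rvM => //; exact: bounded_rv_cst. Qed.

Lemma bounded_rvB f g : bounded_rv f -> bounded_rv g ->
  bounded_rv (fun w => f w - g w).
Proof.
move=> bf bg; rewrite (_ : (fun w => _) = (fun w => f w + (-1) * g w)).
  by apply: bounded_rvD => //; exact: bounded_rvZ.
by apply/funext => w; rewrite mulN1r.
Qed.

Lemma bounded_rv_sum (I : Type) (s : seq I) (Q : pred I) (f : I -> W -> R) :
  (forall i, bounded_rv (f i)) -> bounded_rv (fun w => \sum_(i <- s | Q i) f i w).
Proof.
move=> bf; elim: s => [|i s IH].
  by under eq_fun do rewrite big_nil; exact: bounded_rv_cst.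
case Qi : (Q i); under eq_fun do rewrite big_cons Qi; by [exact: bounded_rvD|].
Qed.

Lemma bounded_rv_integrable P f : bounded_rv f -> P.-integrable setT (EFin \o f).
Proof.
move=> [mf [C fC]]; apply: measurable_bounded_integrable => //.
  by rewrite [ltLHS]probability_setT ltry.
exists C; split; first exact: num_real.
by move=> x Cx w _; apply: le_trans (fC w) _; exact: ltW.
Qed.

Lemma bounded_rv_RintegralD P f g : bounded_rv f -> bounded_rv g ->
  \int[P]_w (f w + g w) = \int[P]_w f w + \int[P]_w g w.
Proof. by move=> bf bg; apply: RintegralD => //; exact: bounded_rv_integrable. Qed.

Lemma bounded_rv_RintegralB P f g : bounded_rv f -> bounded_rv g ->
  \int[P]_w (f w - g w) = \int[P]_w f w - \int[P]_w g w.
Proof. by move=> bf bg; apply: RintegralB => //; exact: bounded_rv_integrable. Qed.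

Lemma bounded_rv_RintegralZ P (a : R) f : bounded_rv f -> \int[P]_w (a * f w) = a * \int[P]_w f w.
Proof. by move=> bf; apply: RintegralZl => //; exact: bounded_rv_integrable. Qed.

Lemma Rintegral_prob_cst P (a : R) : \int[P]_w a = a.
Proof. by rewrite Rintegral_cst// [X in fine X](probability_setT P) mulr1. Qed.

Lemma bounded_rv_le P f g : bounded_rv f -> bounded_rv g -> (forall w, f w <= g w) ->
  \int[P]_w f w <= \int[P]_w g w.
Proof. by move=> bf bg fg; apply: le_Rintegral => //; exact: bounded_rv_integrable. Qed.

Lemma bounded_rv_Rintegral_sum P (I : Type) (s : seq I) (Q : pred I) (f : I -> W -> R) :
  (forall i, bounded_rv (f i)) ->
  \int[P]_w (\sum_(i <- s | Q i) f i w) = \sum_(i <- s | Q i) \int[P]_w f i w.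
Proof.
move=> bf; elim: s => [|i s IH].
  under eq_Rintegral do rewrite big_nil; by rewrite Rintegral_prob_cst big_nil.
rewrite big_cons; case Qi : (Q i); under eq_Rintegral do rewrite big_cons Qi; last by [].
by rewrite bounded_rv_RintegralD ?IH//; exact: bounded_rv_sum.
Qed.

Lemma bounded_rv_EFin P f : bounded_rv f -> (\int[P]_w (f w)%:E)%E = (\int[P]_w f w)%:E.
Proof.
move=> bf; rewrite fineK//; apply: integrable_fin_num => //.
exact: bounded_rv_integrable.
Qed.

Lemma bounded_rv_cvg P (X : nat -> W -> R) (Y : W -> R) (C : R) :
  (forall n, measurable_fun setT (X n)) -> (forall n w, `|X n w| <= C) ->
  (forall w, X n w @[n --> \oo] --> Y w) ->
  \int[P]_w X n w @[n --> \oo] --> \int[P]_w Y w.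
Proof.
move=> mX XC XY.
have mY : measurable_fun setT Y by apply: (measurable_fun_cvg mX) => w _; exact: XY.
have bX n : bounded_rv (X n) by split => //; exists C.
have bY : bounded_rv Y.
  split => //; exists C => w; rewrite ler_norml; apply/andP; split.
    apply: (cvgr_to_ge (XY w)); apply: nearW => n.
    by have := XC n w; rewrite ler_norml => /andP[].
  apply: (cvgr_to_le (XY w)); apply: nearW => n.
  by have := XC n w; rewrite ler_norml => /andP[].
have mXE n : measurable_fun setT (fun w => (X n w)%:E) by exact/measurable_EFinP.
have mYE : measurable_fun setT (fun w => (Y w)%:E) by exact/measurable_EFinP.
have aeXY : {ae P, forall w, setT w -> (X n w)%:E @[n --> \oo] --> (Y w)%:E}.
  by apply: aeW => w _; apply: cvg_EFin; [exact: nearW|exact: XY].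
have iC := bounded_rv_integrable P (bounded_rv_cst C).
have aeXC : {ae P, forall w n, setT w -> (`|(X n w)%:E| <= (EFin \o cst C) w)%E}.
  by apply: aeW => w n _; rewrite lee_fin.
have [_ _ h] := dominated_convergence measurableT mXE mYE aeXY iC aeXC.
apply: fine_cvg; rewrite -bounded_rv_EFin//.
Qed.

(** A form of the reverse Fatou lemma: [X n] lies below its tail supremum, and the tail suprema
    converge boundedly to the upper limit, so dominated convergence applies. *)
Lemma Rintegral_limn_sup_ge P (X : nat -> W -> R) (C : R) :
  (forall n, measurable_fun setT (X n)) -> (forall n w, `|X n w| <= C) ->
  forall e, 0 < e -> exists N, forall n, (N <= n)%N ->
  \int[P]_w X n w <= \int[P]_w limn_sup (X ^~ w) + e.
Proof.
move=> mX XC e e0; have supsP w := bounded_sups (XC ^~ w).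
have msups n : measurable_fun setT (fun w => sups (X ^~ w) n).
  by apply: measurable_fun_sups => // w _; case: (supsP w).
have sups_C n w : `|sups (X ^~ w) n| <= C by case: (supsP w).
have cvg_sups w : sups (X ^~ w) n @[n --> \oo] --> limn_sup (X ^~ w).
  by case: (supsP w).
have := bounded_rv_cvg (P := P) msups sups_C cvg_sups.
move=> /cvgr_le /(_ (\int[P]_w limn_sup (X ^~ w) + e)).
rewrite ltrDl => /(_ e0) [N _ NP]; exists N => n Nn; apply: le_trans (NP n Nn).
apply: bounded_rv_le => [||w]; [by split => //; exists C|by split => //; exists C|].
by apply: ub_le_sup; [apply: has_ubound_sdrop; case: (supsP w)|exists n => /=].
Qed.

(** The tails of [psi] are pathwise errors with summable expectations. Starting late enough, their
    total has expectation at most [e], and integrating the pathwise bound replaces an almost sure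
    argument. *)
Lemma Rintegral_limn_sup_le P (X psi Y : nat -> W -> R) (C B D : R) :
  (forall n, measurable_fun setT (X n)) -> (forall n w, `|X n w| <= C) ->
  (forall n, bounded_rv (psi n)) -> (forall n w, 0 <= psi n w) ->
  (forall n, \sum_(0 <= j < n) \int[P]_w psi j w <= B) ->
  (forall n, bounded_rv (Y n)) -> (forall n, \int[P]_w Y n w <= D) ->
  (forall N w t, (forall n, \sum_(N <= j < n) psi j w <= t) ->
    limn_sup (X ^~ w) <= Y N w + t) ->
  \int[P]_w limn_sup (X ^~ w) <= D.
Proof.
move=> mX XC bpsi psi0 psiB bY YD XY.
apply/ler_addgt0Pr => e e0.
have supsP w := bounded_sups (XC ^~ w).
have bL : bounded_rv (fun w => limn_sup (X ^~ w)).
  split.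
    by apply: measurable_fun_limn_sup => // w _; case: (supsP w).
  exists C => w; have [_ _ sups_C cvg_sups] := supsP w.
  rewrite ler_norml; apply/andP; split.
    apply: (cvgr_to_ge cvg_sups); apply: nearW => n.
    by have := sups_C n; rewrite ler_norml => /andP[].
  apply: (cvgr_to_le cvg_sups); apply: nearW => n.
  by have := sups_C n; rewrite ler_norml => /andP[].
pose u n := \sum_(0 <= j < n) \int[P]_w psi j w.
have usup : has_sup (range u).
  by split; [exists (u 0%N), 0%N|exists B => _ [n _ <-]; exact: psiB].
(* At this [N] the partial sums are within [e] of their supremum, so the tail from [N] on has
   integral at most [e]. *)
have [_ [N _ <-] uN] := sup_adherent e0 usup.
pose S w := (\sum_(0 <= k <oo) (psi (N + k)%N w)%:E)%E.
have S0 w : (0 <= S w)%E by apply: nneseries_ge0 => n _ _; rewrite lee_fin.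
have mpsi n : measurable_fun setT (fun w => (psi n w)%:E).
  by apply/measurable_EFinP; case: (bpsi n).
have mS : measurable_fun setT S.
  by apply: (ge0_emeasurable_sum (P := xpredT)) => [k w _ _|k _]; rewrite ?lee_fin.
have intS : (\int[P]_w S w <= e%:E)%E.
  rewrite integral_nneseries//; last by move=> n w _; rewrite lee_fin.
  apply: lime_le.
    by apply: is_cvg_nneseries => n _ _; apply: integral_ge0 => w _; rewrite lee_fin.
  apply: nearW => n; under eq_bigr do rewrite bounded_rv_EFin//.
  rewrite sumEFin lee_fin.
  have -> : \sum_(0 <= k < n) \int[P]_w psi (N + k)%N w = u (N + n)%N - u N.
    have -> : u (N + n)%N = u N + \sum_(N <= j < N + n) \int[P]_w psi j w.
      by rewrite /u -big_cat_nat ?leq_addr.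
    rewrite addrC addKr.
    rewrite -[in RHS](add0n N) big_addn add0n addKn.
    by apply: eq_bigr => k _; rewrite addnC.
  have : u (N + n)%N <= sup (range u) by apply: ub_le_sup; [case: usup|exists (N + n)%N].
  by move: uN; lra.
have [A YA] := (bY N).2; have [A' LA'] := bL.2.
(* Shifting by [c] makes both sides nonnegative, as the comparison of integrals with the possibly
   infinite [S] requires. *)
pose c := A + A'.
have c0 w : 0 <= limn_sup (X ^~ w) + c /\ 0 <= Y N w + c.
  have := YA w; have := LA' w; rewrite !ler_norml /c => /andP[h1 h2] /andP[h3 h4].
  by split; lra.
have bYc := bounded_rvD (bY N) (bounded_rv_cst c).
have bLc := bounded_rvD bL (bounded_rv_cst c).
have mY : measurable_fun setT (fun w => (Y N w + c)%:E).
  by apply/measurable_EFinP; case: bYc.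
have : (\int[P]_w (limn_sup (X ^~ w) + c)%:E <= \int[P]_w ((Y N w + c)%:E + S w))%E.
  apply: ge0_le_integral => //.
  - by move=> w _; rewrite lee_fin; case: (c0 w).
  - by apply/measurable_EFinP; case: bLc.
  - exact: emeasurable_funD.
  (* Where the tail sum is infinite the inequality is trivial. *)
  - move=> w _; case ES : (S w) (S0 w) => [t| |]//.
      move=> _; rewrite -EFinD lee_fin addrAC lerD2r.
      apply: XY => n; rewrite -lee_fin -ES.
      apply: le_trans (nneseries_lim_ge (n - N)%N _) => /=; last first.
        by move=> k _ _; rewrite lee_fin.
      rewrite sumEFin lee_fin; have [nN|Nn] := leqP n N.
        by rewrite !big_geq// leqn0 subn_eq0.
      rewrite -(add0n N) big_addn add0n; apply: ler_sum => k _.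
      by rewrite addnC.
    by move=> _; rewrite addey// leey.
rewrite ge0_integralD//; last by move=> w _; rewrite lee_fin; case: (c0 w).
move=> /le_trans /(_ (leeD2l _ intS)).
rewrite !bounded_rv_EFin// -EFinD lee_fin !bounded_rv_RintegralD//; try exact: bounded_rv_cst.
by have := YD N; rewrite !Rintegral_prob_cst; lra.
Qed.

End bounded_random_variables.

(** * Finite Markov chains *)

Section markov_chain.
Context (R : realType) (T : pointedFinType) (q : T -> R) (K : T -> T -> R).
Context (mu : probability (trajectory T) R).
Hypothesis muP : is_markov_law q K mu.
Implicit Types (w : trajectory T) (f : T -> T -> R) (g : T -> R).

Definition cylinder (n : nat) (h : nat -> T) : set (trajectory T) :=
  [set w | forall i, (i < n.+1)%N -> w i = h i].

(** Measurability with respect to the first n + 1 coordinates; as [T] is finite, such a function is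
    a finite combination of indicators of cylinders. *)
Definition adapted (n : nat) (Phi : trajectory T -> R) :=
  forall w w', (forall i, (i <= n)%N -> w i = w' i) -> Phi w = Phi w'.

Lemma measurable_cylinder n h : measurable (cylinder n h).
Proof.
have -> : cylinder n h = \bigcap_(i in [set i | (i < n.+1)%N]) [set w | w i = h i].
  by apply/seteqP; split.
apply: bigcap_measurable; first by exists 0%N.
by move=> k _; apply: sub_sigma_algebra; exists k, (h k).
Qed.

Let prob n h : R := q (h 0%N) * \prod_(i < n) K (h i) (h i.+1).

Let indic_rv n h : bounded_rv (\1_(cylinder n h) : trajectory T -> R).
Proof.
split; first by apply: measurable_indic; exact: measurable_cylinder.
by exists 1 => w; rewrite indicE; case: (_ \in _); rewrite ?normr1 ?normr0.
Qed.

Let Rintegral_cylinder n h : \int[mu]_w \1_(cylinder n h) w = prob n h.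
Proof.
have mA := measurable_cylinder n h.
by rewrite /Rintegral integral_indic// setIT [X in fine X]muP.
Qed.

Let extend n (h : nat -> T) y i := if (i <= n)%N then h i else y.

Let prob_extend n h y : prob n.+1 (extend n h y) = prob n h * K (h n) y.
Proof.
rewrite /prob big_ord_recr mulrA; congr (_ * _ * _).
  by apply: eq_bigr => i _; rewrite /extend /= ltn_ord ltnW.
by rewrite /extend leqnn ltnn.
Qed.

Let indic_extend n h f w :
  \sum_y f (h n) y * \1_(cylinder n.+1 (extend n h y)) w =
  f (w n) (w n.+1) * \1_(cylinder n h) w.
Proof.
rewrite [in RHS]indicE; have [wh|nwh] := boolP (w \in _).
  rewrite mulr1 (bigD1 (w n.+1))//= big1 ?addr0; last first.
    move=> y /eqP yw; rewrite indicE memNset ?mulr0//= => /(_ n.+1 (ltnSn _)).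
    by rewrite /extend ltnn => /esym.
  move: wh; rewrite inE /= => wh; rewrite indicE mem_set ?mulr1 ?(wh n)//=.
  move=> i ilt; rewrite /extend; case: ifP => [ile|nle]; first exact: wh.
  by congr w; lia.
rewrite mulr0 big1// => y _; rewrite indicE memNset ?mulr0//= => wh.
have wn : cylinder n h w.
  by move=> i ile; rewrite (wh i (leqW ile)) /extend -ltnS ile.
by move: nwh; rewrite mem_set.
Qed.

(** Beyond index [n] the sequence takes the default of [inord], which neither a cylinder of level
    [n] nor an adapted function sees. *)
Let word n (u : {ffun 'I_n.+1 -> T}) i := u (inord i).

Let adaptedE n Phi w : adapted n Phi ->
  Phi w = \sum_u Phi (@word n u) * \1_(cylinder n (word u)) w.
Proof.
move=> aPhi; pose u0 := [ffun i : 'I_n.+1 => w i].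
have u0E i : (i <= n)%N -> w i = word u0 i by move=> ile; rewrite /word ffunE inordK.
rewrite (bigD1 u0)//= indicE mem_set /= ?mulr1; last by move=> i; exact: u0E.
rewrite big1 ?addr0; first exact: aPhi.
move=> u /eqP uu0; rewrite indicE memNset ?mulr0//= => wu; apply: uu0.
by apply/ffunP => i; rewrite ffunE wu// /word inord_val.
Qed.

Lemma adapted_bounded_rv n Phi : adapted n Phi -> bounded_rv Phi.
Proof.
move=> aPhi; rewrite (_ : Phi = fun w =>
    \sum_u Phi (@word n u) * \1_(cylinder n (word u)) w).
  by apply: bounded_rv_sum => u; apply: bounded_rvZ; exact: indic_rv.
by apply/funext => w; exact: adaptedE.
Qed.

Lemma adapted_step n f : adapted n.+1 (fun w => f (w n) (w n.+1)).
Proof. by move=> w w' ww'; rewrite !ww'. Qed.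

Lemma adapted_coord n g : adapted n (fun w => g (w n)).
Proof. by move=> w w' ww'; rewrite ww'. Qed.

(** The Markov property without conditional expectations: [Phi] is expanded over cylinders, and
    appending a letter [y] to a word ending in [x] multiplies its probability by [K x y]. *)
Lemma markov_step n Phi f : adapted n Phi ->
  \int[mu]_w (Phi w * f (w n) (w n.+1)) =
  \int[mu]_w (Phi w * kapp K (f (w n)) (w n)).
Proof.
move=> aPhi.
pose F w := \sum_u Phi (@word n u) *
  \sum_y f (word u n) y * \1_(cylinder n.+1 (extend n (word u) y)) w.
transitivity (\int[mu]_w F w).
  congr Rintegral; apply/funext => w; rewrite (adaptedE w aPhi) mulr_suml.
  by apply: eq_bigr => u _; rewrite indic_extend -mulrA (mulrC (\1__ _)).
pose G w := \sum_u (Phi (@word n u) * kapp K (f (word u n)) (word u n)) *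
  \1_(cylinder n (word u)) w.
transitivity (\int[mu]_w G w); last first.
  congr Rintegral; apply/funext => w.
  rewrite [RHS](@adaptedE n (fun w => Phi w * kapp K (f (w n)) (w n)))//.
  by move=> v v' vv'; rewrite (aPhi _ _ vv') vv'.
rewrite !bounded_rv_Rintegral_sum; last 2 first.
- by move=> u; apply: bounded_rvZ; exact: indic_rv.
- move=> u; apply: bounded_rvZ; apply: bounded_rv_sum => y.
  by apply: bounded_rvZ; exact: indic_rv.
apply: eq_bigr => u _; rewrite !bounded_rv_RintegralZ; last 2 first.
- exact: indic_rv.
- by apply: bounded_rv_sum => y; apply: bounded_rvZ; exact: indic_rv.
rewrite bounded_rv_Rintegral_sum; last by move=> y; apply: bounded_rvZ; exact: indic_rv.
rewrite Rintegral_cylinder -mulrA; congr (_ * _); rewrite /kapp mulr_suml.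
apply: eq_bigr => y _; rewrite bounded_rv_RintegralZ; last exact: indic_rv.
rewrite Rintegral_cylinder prob_extend; ring.
Qed.

Lemma markov_step1 n f :
  \int[mu]_w f (w n) (w n.+1) = \int[mu]_w kapp K (f (w n)) (w n).
Proof.
transitivity (\int[mu]_w (1 * f (w n) (w n.+1))).
  by congr Rintegral; apply/funext => w; rewrite mul1r.
rewrite (@markov_step n (fun=> 1))//.
by congr Rintegral; apply/funext => w; rewrite mul1r.
Qed.

Lemma markov_init g : \int[mu]_w g (w 0%N) = \sum_x q x * g x.
Proof.
transitivity (\int[mu]_w \sum_x g x * \1_(cylinder 0 (fun=> x)) w).
  congr Rintegral; apply/funext => w; rewrite (bigD1 (w 0%N))//= indicE mem_set; last first.
    by move=> [].
  rewrite mulr1 big1 ?addr0// => x /eqP xw; rewrite indicE memNset ?mulr0//=.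
  by move=> /(_ 0%N isT) /esym.
rewrite bounded_rv_Rintegral_sum; last by move=> x; apply: bounded_rvZ; exact: indic_rv.
apply: eq_bigr => x _; rewrite bounded_rv_RintegralZ; last exact: indic_rv.
by rewrite Rintegral_cylinder /prob big_ord0 mulr1 mulrC.
Qed.

End markov_chain.

(** * Deterministic estimates on real sequences *)

Lemma sqrt_bracket n : exists k, (k ^ 2 <= n < k.+1 ^ 2)%N.
Proof.
elim: n => [|n [k /andP[k1 k2]]]; first by exists 0%N.
have [kn|nk] := ltnP n.+1 (k.+1 ^ 2); first by exists k; rewrite kn andbT leqW.
by exists k.+1; rewrite nk (leq_ltn_trans k2)// ltn_sqr.
Qed.

(* The averages of the martingale d are controlled along the squares, where
   their mean squares are summable, and between consecutive squares by the
   bound on the increments. *)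
Lemma path_average_le (R : realType) (c d f h : nat -> R) (D B H e eta tau : R)
    (N : nat) :
  0 < eta -> (forall t, `|d t| <= D) -> (forall t, `|f t| <= B) ->
  (forall t, `|h t| <= H) ->
  (forall t, c t <= d t + f t + e + h t - h t.+1) ->
  (forall n, \sum_(N <= j < n) (2 * `|f j.+1 - f j| + 2 / eta *
    ((j ^ 2)%:R^-1 * \sum_(0 <= t < j ^ 2) d t) ^+ 2) <= tau) ->
  exists N0, forall n, (N0 <= n)%N ->
    n.+1%:R^-1 * \sum_(t < n.+1) c t <= f N + e + 2 * eta + tau.
Proof.
move=> eta0 dD fB hH cle Stau.
pose M n := \sum_(0 <= t < n) d t.
pose x k := (k ^ 2)%:R^-1 * M (k ^ 2)%N.
have eta2 : 0 <= 2 / eta by rewrite divr_ge0// ltW.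
have term0 j : 0 <= 2 * `|f j.+1 - f j| /\ 0 <= 2 / eta * x j ^+ 2.
  by rewrite mulr_ge0// mulr_ge0// sqr_ge0.
have D0 : 0 <= D by exact: le_trans (dD 0%N).
have B0 : 0 <= B by exact: le_trans (fB 0%N).
have H0 : 0 <= H by exact: le_trans (hH 0%N).
(* The increments of [f] after time [N] telescope and use half of the budget [tau]. *)
have fvar t : (N <= t)%N -> f t <= f N + tau / 2.
  move=> Nt; have : f t - f N <= \sum_(N <= j < t) `|f j.+1 - f j|.
    by rewrite -(telescope_sumr f Nt); apply: ler_sum => j _; exact: ler_norm.
  have : 2 * \sum_(N <= j < t) `|f j.+1 - f j| <= tau.
    apply: le_trans (Stau t); rewrite mulr_sumr; apply: ler_sum => j _.
    by rewrite lerDl; case: (term0 j).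
  lra.
(* The budget gives x ^ 2 / eta <= tau / 2, and x <= eta + x ^ 2 / eta holds for every real x. *)
have xk k : (N <= k)%N -> x k <= eta + tau / 2.
  move=> Nk; have H1 : 2 / eta * x k ^+ 2 <= tau.
    apply: le_trans (Stau k.+1); rewrite big_nat_recr//= -/(M _) -/(x k).
    have : 0 <= \sum_(N <= j < k) (2 * `|f j.+1 - f j| + 2 / eta * x j ^+ 2).
      by apply: sumr_ge0 => j _; have [] := term0 j; lra.
    by have [] := term0 k; rewrite /x /M; lra.
  have : x k <= eta + x k ^+ 2 / eta.
    rewrite -(ler_pM2r eta0) mulrDl divfK ?gt_eqF//.
    by have := sqr_ge0 (x k - eta); nra.
  by move: H1; rewrite mulrAC; lra.
have sumc n : \sum_(0 <= t < n) c t <=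
    M n + \sum_(0 <= t < n) f t + n%:R * e + h 0%N - h n.
  rewrite /M; elim: n => [|n IH]; first by rewrite !big_geq// mul0r; lra.
  by rewrite !big_nat_recr//= -natr1 mulrDl mul1r; have := cle n; lra.
(* Only the terms before time [N] escape [fvar]; each of them costs at most 2 B. *)
have sumf n : \sum_(0 <= t < n) f t <=
    n%:R * (f N + tau / 2) + 2 * B * (minn n N)%:R.
  elim: n => [|n IH]; first by rewrite big_geq// min0n mul0r mulr0 addr0.
  rewrite big_nat_recr//= -natr1 mulrDl mul1r.
  have tau0 : 0 <= tau by have := Stau N; rewrite big_geq.
  have [Nn|nN] := leqP N n.
    have -> : minn n.+1 N = minn n N by lia.
    by have := fvar n Nn; lra.
  have -> : minn n.+1 N = (minn n N).+1 by lia.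
  rewrite -[(minn n N).+1%:R]natr1.
  have := fB n; have := fB N; rewrite !ler_norml => /andP[h1 h2] /andP[h3 h4].
  lra.
have Mdiff m n : (m <= n)%N -> M n <= M m + (n - m)%:R * D.
  move=> mn; rewrite /M (@big_cat_nat _ _ _ m 0 n)//= lerD2l.
  apply: (@le_trans _ _ (\sum_(m <= t < n) D)).
    by apply: ler_sum => t _; exact: le_trans (ler_norm _) (dD t).
  by rewrite sumr_const_nat mulr_natl.
(* For k >= 1 the gap of at most 2 k steps after the square, the terms before [N] and the boundary
   values of [h] cost at most k E in all. Once k >= E / eta this is at most eta k ^ 2, hence at most
   [eta] per step; [k0] is chosen accordingly. *)
pose E := 2 * D + 2 * B * N%:R + 2 * H.
have E0 : 0 <= E by rewrite /E !addr_ge0// !mulr_ge0.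
pose k0 := (maxn N (Num.truncn (E / eta))).+1.
exists (k0 ^ 2)%N => n k0n; rewrite -(big_mkord xpredT c).
have [k /andP[kn nk]] := sqrt_bracket n.+1.
have k0k : (k0 <= k)%N.
  by rewrite -ltnS -ltn_sqr; apply: leq_ltn_trans nk; exact: leq_trans k0n _.
have Nk : (N <= k)%N by apply: leq_trans k0k; rewrite /k0; lia.
have k_gt0 : 0 < k%:R :> R by rewrite ltr0n; apply: leq_trans k0k.
have Ek : E <= eta * k%:R.
  rewrite mulrC -ler_pdivrMr//; apply: ltW; apply: lt_le_trans (truncnS_gt _) _.
  by rewrite ler_nat; apply: leq_trans k0k; rewrite /k0 ltnS leq_maxr.
set m := n.+1; have m0 : 0 < m%:R :> R by rewrite ltr0Sn.
rewrite ler_pdivrMl//.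
have k2m : (k%:R : R) ^+ 2 <= m%:R by rewrite -natrX ler_nat.
have m2 : (m - k ^ 2)%:R <= 2 * k%:R :> R.
  by rewrite -natrM ler_nat; move: nk; rewrite /m; nia.
have H1 := sumc m; have H2 := sumf m; have H3 := Mdiff _ _ kn.
have H4 : (minn m N)%:R <= N%:R :> R by rewrite ler_nat geq_minr.
have H5 : M (k ^ 2)%N = k%:R ^+ 2 * x k.
  by rewrite /x natrX mulrA divff ?mul1r// expf_neq0// gt_eqF.
have H6 := xk k Nk.
have tau0 : 0 <= tau by have := Stau N; rewrite big_geq.
have H7 : k%:R ^+ 2 * x k <= m%:R * (eta + tau / 2).
  apply: (@le_trans _ _ (k%:R ^+ 2 * (eta + tau / 2))).
    by rewrite ler_wpM2l// sqr_ge0.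
  by rewrite ler_wpM2r//; lra.
have H8 : (m - k ^ 2)%:R * D <= 2 * k%:R * D by rewrite ler_wpM2r.
have k1 : 1 <= k%:R :> R by rewrite ler1n; apply: leq_trans k0k.
have H9 : 2 * k%:R * D + 2 * B * N%:R + 2 * H <= k%:R * E.
  have HB : 0 <= 2 * B * N%:R by rewrite !mulr_ge0.
  by rewrite /E; nra.
have H10 : k%:R * E <= eta * m%:R.
  apply: (@le_trans _ _ (k%:R * (eta * k%:R))); first by rewrite ler_wpM2l// ltW.
  by rewrite mulrCA; apply: ler_wpM2l; [exact: ltW|rewrite -expr2].
have H11 : 2 * B * (minn m N)%:R <= 2 * B * N%:R by rewrite ler_wpM2l// mulr_ge0.
have := hH 0%N; have := hH m; rewrite !ler_norml => /andP[h1 h2] /andP[h3 h4].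
rewrite (_ : m%:R * _ = m%:R * (eta + tau / 2) + m%:R * (f N + tau / 2) + m%:R * e +
  eta * m%:R); last by field.
lra.
Qed.

Lemma abel_summation (R : realType) (d : nat -> R) (a B : R) n : 0 <= a <= 1 ->
  (forall m, \sum_(0 <= t < m) d t <= B) -> 0 <= B ->
  \sum_(0 <= t < n) a ^+ t * d t <= B.
Proof.
move=> /andP[a0 a1] dB B0.
have an m : 0 <= a ^+ m by rewrite exprn_ge0.
(* In this form the induction closes: the step amounts to (a ^ n - a ^ (n + 1)) (B - S) >= 0, with S
   the partial sum up to and including [d n]. *)
suff : \sum_(0 <= t < n) a ^+ t * d t - a ^+ n * \sum_(0 <= t < n) d t <=
    B * (1 - a ^+ n).
  by have := ler_wpM2l (an n) (dB n); lra.
elim: n => [|n IH]; first by rewrite !big_geq// mulr0 subr0 expr0 subrr mulr0.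
have := dB n.+1; rewrite !big_nat_recr//= exprSr.
move: IH (an n); set x := a ^+ n; set y := \sum_(0 <= t < n) a ^+ t * d t.
set z := \sum_(0 <= t < n) d t.
move=> H1 x0 H2; have : 0 <= (x - x * a) * (B - (z + d n)).
  by apply: mulr_ge0; [nra|lra].
by lra.
Qed.

Lemma sum_inv_sqr_le (R : realType) n : \sum_(0 <= j < n) ((j%:R : R) ^+ 2)^-1 <= 2.
Proof.
(* Telescoping through 1 / (x + 1) ^ 2 <= 1 / x - 1 / (x + 1); the term of index 0 is 0 because 0 is
   its own inverse. *)
have H m : \sum_(0 <= j < m.+2) ((j%:R : R) ^+ 2)^-1 <= 2 - m.+1%:R^-1.
  elim: m => [|m IH].
    by rewrite !big_nat_recl// big_geq// expr0n/= expr1n !invr0 !invr1; lra.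
  rewrite big_nat_recr//=; have m0 : 0 < m.+1%:R :> R by rewrite ltr0Sn.
  have -> : m.+2%:R = m.+1%:R + 1 :> R by rewrite -natr1.
  move: IH m0; move: (m.+1%:R : R) => x IH x0.
  have : ((x + 1) ^+ 2)^-1 <= x^-1 - (x + 1)^-1.
    have -> : x^-1 - (x + 1)^-1 = (x * (x + 1))^-1 by field; lra.
    by rewrite lef_pV2 ?posrE; nra.
  by lra.
have H2 : \sum_(0 <= j < n) ((j%:R : R) ^+ 2)^-1 <=
    \sum_(0 <= j < n.+2) ((j%:R : R) ^+ 2)^-1.
  rewrite !big_nat_recr//= -addrA lerDl addr_ge0// invr_ge0 sqr_ge0//.
apply: (le_trans H2); apply: (le_trans (H n)).
by rewrite gerBl invr_ge0.
Qed.

(** * Discounted and average returns of one Markov chain *)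

Section chain_returns.
Context (R : realType) (T : pointedFinType) (q : T -> R) (K : T -> T -> R).
Context (mu : probability (trajectory T) R) (c : T -> T -> R).
Hypothesis KP : forall x, simplex (K x).
Hypothesis muP : is_markov_law q K mu.
Implicit Types (w : trajectory T) (g : T -> R).

Let cost w t : R := c (w t) (w t.+1).

Let cost_rv t : bounded_rv (cost ^~ t).
Proof. exact: adapted_bounded_rv (@adapted_step _ _ t c). Qed.

Let coord_rv t g : bounded_rv (fun w : trajectory T => g (w t)).
Proof. exact: adapted_bounded_rv (@adapted_coord _ _ t g). Qed.

Let costC : exists2 C : R, 0 <= C & forall w t, `|cost w t| <= C.
Proof.
have [C C0 cC] := finfun_bounded (fun z : T * T => c z.1 z.2).
by exists C => // w t; exact: (cC (w t, w t.+1)).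
Qed.

Lemma Rintegral_kapp g n : \int[mu]_w g (w n.+1) = \int[mu]_w kapp K g (w n).
Proof. exact: (markov_step1 muP n (fun _ y => g y)). Qed.

(** The value equation, integrated at time [n], trades the remainder at [n] for the expected cost
    and the remainder at n + 1. *)
Lemma discounted_partial (a : R) v n : is_value c a K v ->
  (1 - a) * \sum_(0 <= t < n) a ^+ t * \int[mu]_w cost w t =
  \sum_x q x * v x - a ^+ n * \int[mu]_w v (w n).
Proof.
move=> vK; elim: n => [|n IH].
  by rewrite big_geq// mulr0 expr0 mul1r (markov_init muP) subrr.
rewrite big_nat_recr//= mulrDr IH (markov_step1 muP n c) Rintegral_kapp exprSr.
have E : \int[mu]_w v (w n) = (1 - a) * \int[mu]_w kapp K (c (w n)) (w n) +
    a * \int[mu]_w kapp K v (w n).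
  have b1 := coord_rv n (fun x => kapp K (c x) x).
  have b2 := coord_rv n (kapp K v).
  rewrite -(bounded_rv_RintegralZ mu _ b1) -(bounded_rv_RintegralZ mu _ b2).
  rewrite -bounded_rv_RintegralD; try exact: bounded_rvZ.
  by congr Rintegral; apply/funext => w; exact: vK.
rewrite E; ring.
Qed.

Lemma Rintegral_coord_bounded g (B : R) n : (forall x, `|g x| <= B) ->
  `|\int[mu]_w g (w n)| <= B.
Proof.
move=> gB; rewrite ler_norml -(Rintegral_prob_cst mu (- B)).
rewrite -[X in _ && (_ <= X)](Rintegral_prob_cst mu B).
by apply/andP; split; apply: bounded_rv_le; try exact: bounded_rv_cst; try exact: coord_rv;
  move=> w; have := gB (w n); rewrite ler_norml => /andP[].
Qed.

Lemma discounted_value (a : R) v : 0 <= a < 1 -> is_value c a K v ->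
  (1 - a) * \int[mu]_w limn (series (fun t => a ^+ t * cost w t)) =
  \sum_x q x * v x.
Proof.
move=> /andP[a0 a1] vK; have [C C0 cC] := costC.
have na : `|a| < 1 by rewrite ger0_norm.
have bound w n : \sum_(0 <= t < n) `|a ^+ t * cost w t| <= C / (1 - a).
  rewrite ler_pdivlMr ?subr_gt0//.
  (* The induction needs the sharper bound C - C a ^ n. *)
  have -> : C = C * a ^+ 0 by rewrite expr0 mulr1.
  apply: (@le_trans _ _ (C * a ^+ 0 - C * a ^+ n)); last first.
    by rewrite gerBl mulr_ge0// exprn_ge0.
  elim: n => [|n IH]; first by rewrite big_geq// mul0r subrr.
  rewrite big_nat_recr//= mulrDl.
  have : `|a ^+ n * cost w n| <= a ^+ n * C.
    by rewrite normrM ger0_norm ?exprn_ge0// ler_wpM2l ?exprn_ge0.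
  have : 0 <= a ^+ n by rewrite exprn_ge0.
  move: IH; rewrite exprSr; move: (a ^+ n) `|_| => an x; nra.
have mX n : measurable_fun setT (fun w => series (fun t => a ^+ t * cost w t) n).
  by apply: measurable_sum => t; case: (bounded_rvZ (a ^+ t) (cost_rv t)).
have XC n w : `|series (fun t => a ^+ t * cost w t) n| <= C / (1 - a).
  by apply: le_trans (bound w n); exact: ler_norm_sum.
have Xcvg w : series (fun t => a ^+ t * cost w t) n @[n --> \oo] -->
    limn (series (fun t => a ^+ t * cost w t)).
  apply: (@normed_cvg _ R^o (fun t => a ^+ t * cost w t)).
  apply: nondecreasing_is_cvgn.
    by apply: nondecreasing_series => n _ _; exact: normr_ge0.
  by exists (C / (1 - a)) => _ [n _ <-]; exact: bound.
have ElimX := bounded_rv_cvg (P := mu) mX XC Xcvg.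
have H1 := cvgM (FF := eventually_filter) (cvg_cst (FF := eventually_filter) (1 - a)) ElimX.
apply: (cvg_eq_lim (F := \oo) (g := fun n =>
  \sum_x q x * v x - a ^+ n * \int[mu]_w v (w n)) H1); last first.
  apply: nearW => n /=; rewrite -discounted_partial//; congr (_ * _).
  rewrite /series /= bounded_rv_Rintegral_sum; last by move=> t; exact: bounded_rvZ.
  by apply: eq_bigr => t _; rewrite bounded_rv_RintegralZ.
have [B B0 vB] := finfun_bounded v.
have H2 : a ^+ n * \int[mu]_w v (w n) @[n --> \oo] --> (0 : R).
  apply: norm_cvg0; apply: (@squeeze_cvgr _ _ _ _ (fun=> 0) (fun n => geometric B a n)).
  - apply: nearW => n; rewrite normr_ge0/= normrM ger0_norm ?exprn_ge0//.
    by rewrite mulrC ler_wpM2r ?exprn_ge0// Rintegral_coord_bounded.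
  - exact: cvg_cst.
  - exact: cvg_geometric.
have : \sum_x q x * v x - a ^+ n * \int[mu]_w v (w n) @[n --> \oo] -->
    \sum_x q x * v x - 0 by apply: cvgB => //; exact: cvg_cst.
by rewrite subr0.
Qed.

Let average w n : R := n.+1%:R^-1 * \sum_(t < n.+1) cost w t.

Let average_meas n : measurable_fun setT (average ^~ n).
Proof.
have [//] : bounded_rv (average ^~ n).
by apply: bounded_rvZ; apply: bounded_rv_sum => t; exact: cost_rv.
Qed.

Let average_bound (C : R) w n : (forall t, `|cost w t| <= C) -> `|average w n| <= C.
Proof.
move=> cC; rewrite /average normrM [X in X * _]ger0_norm ?invr_ge0 ?ler0n//.
rewrite ler_pdivrMl ?ltr0Sn//; apply: le_trans; first exact: ler_norm_sum.
apply: (@le_trans _ _ (\sum_(t < n.+1) C)); first exact: ler_sum.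
by rewrite sumr_const card_ord -[leLHS]mulr_natl.
Qed.

(** From some time on the expected averages are at most [L], so the partial sums of the expected
    costs minus [L] are bounded by some [A], and Abel summation carries this over to discounted
    sums. [A] depends on the chain but not on [a], so the last term vanishes as [a] tends to 1. *)
Lemma discounted_le_average (e : R) : 0 < e -> exists A, forall (a : R) v,
  0 <= a < 1 -> is_value c a K v ->
  \sum_x q x * v x <= \int[mu]_w limn_sup (average w) + e + (1 - a) * A.
Proof.
move=> e0; have [C C0 cC] := costC.
have [N NP] := Rintegral_limn_sup_ge mu average_meas (fun n w => average_bound n (cC w)) e0.
pose L := \int[mu]_w limn_sup (average w) + e.
pose A := N%:R * (C + `|L|).
have A0 : 0 <= A by rewrite mulr_ge0// addr_ge0.
exists A => a v a01 vK; have /andP[a0 a1] := a01.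
pose dd t := \int[mu]_w cost w t - L.
have EC t : `|\int[mu]_w cost w t| <= C.
  have [c1 c2] : (forall w, - C <= cost w t) /\ (forall w, cost w t <= C).
    by split=> w; have := cC w t; rewrite ler_norml => /andP[].
  rewrite ler_norml -{1}(Rintegral_prob_cst mu (- C)).
  rewrite -[X in _ && (_ <= X)](Rintegral_prob_cst mu C).
  by rewrite !bounded_rv_le//; exact: bounded_rv_cst.
have dA m : \sum_(0 <= t < m) dd t <= A.
  have [mN|Nm] := leqP m N.
    apply: (@le_trans _ _ (\sum_(0 <= t < m) (C + `|L|))).
      apply: ler_sum => t _; rewrite /dd; have := EC t; rewrite ler_norml => /andP[_].
      by have := ler_norm (- L); rewrite normrN; lra.
    rewrite sumr_const_nat subn0 -[leLHS]mulr_natl ler_wpM2r ?addr_ge0//.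
    by rewrite ler_nat.
  (* The average of index [m] has m + 1 terms, so beyond [N] the partial sum is nonpositive. *)
  case: m Nm => // m Nm; apply: le_trans A0.
  rewrite /dd sumrB sumr_const_nat subn0 subr_le0.
  have := NP m Nm; rewrite -/L bounded_rv_RintegralZ; last first.
    by apply: bounded_rv_sum => t; exact: cost_rv.
  rewrite bounded_rv_Rintegral_sum; last by move=> t; exact: cost_rv.
  by rewrite ler_pdivrMl ?ltr0Sn// big_mkord mulr_natl.
have geom n : (1 - a) * \sum_(0 <= t < n) a ^+ t * L = L * (1 - a ^+ n).
  elim: n => [|n IH]; first by rewrite big_geq// expr0 subrr !mulr0.
  by rewrite big_nat_recr//= mulrDr IH exprSr; ring.
have [B B0 vB] := finfun_bounded v.
have na : `|a| < 1 by rewrite ger0_norm.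
have pcvg : a ^+ n @[n --> \oo] --> (0 : R).
  by apply: cvg_trans (cvg_geometric 1 na); apply: near_eq_cvg; apply: nearW => n /=; rewrite mul1r.
have bnd n : \sum_x q x * v x <= L + (1 - a) * A + a ^+ n * (`|L| + B).
  have := discounted_partial n vK.
  have E t : \int[mu]_w cost w t = dd t + L by rewrite /dd subrK.
  under eq_bigr do rewrite E mulrDr.
  rewrite big_split mulrDr geom /= => E'.
  have H1 := abel_summation n (_ : 0 <= a <= 1) dA A0.
  have {}H1 : (1 - a) * \sum_(0 <= t < n) a ^+ t * dd t <= (1 - a) * A.
    by apply: ler_wpM2l; [lra|apply: H1; rewrite a0 ltW].
  have H2 := Rintegral_coord_bounded n vB; move: H2; rewrite ler_norml => /andP[_ H2].
  have an : 0 <= a ^+ n by rewrite exprn_ge0.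
  have H3 := ler_wpM2l an H2; have H4 := ler_wpM2l an (ler_norm (- L)).
  by rewrite normrN in H4; lra.
have cvgb : L + (1 - a) * A + a ^+ n * (`|L| + B) @[n --> \oo] -->
    L + (1 - a) * A + 0 * (`|L| + B).
  apply: cvgD; first exact: cvg_cst.
  by apply: cvgM; [exact: pcvg|exact: cvg_cst].
rewrite mul0r addr0 in cvgb.
by apply: (cvgr_to_ge cvgb); apply: nearW.
Qed.

(** The bound is uniform over kernels, so that the [inf] of the average returns is a genuine
    infimum. *)
Lemma average_ge (C : R) : (forall x y, `|c x y| <= C) ->
  - C <= \int[mu]_w limn_sup (average w).
Proof.
move=> cC; apply/ler_addgt0Pr => e e0.
have aC n w : `|average w n| <= C by apply: average_bound => t; exact: cC.
have [N NP] := Rintegral_limn_sup_ge mu average_meas aC e0.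
apply: le_trans (NP N (leqnn N)); rewrite -(Rintegral_prob_cst mu (- C)).
apply: bounded_rv_le; first exact: bounded_rv_cst.
  by split; [exact: average_meas|exists C; exact: aC].
by move=> w; have := aC N w; rewrite ler_norml => /andP[].
Qed.

Lemma Rintegral_superharmonic f n : (forall x, kapp K f x <= f x) ->
  \int[mu]_w f (w n) <= \sum_x q x * f x.
Proof.
move=> Kf; elim: n => [|n IH]; first by rewrite (markov_init muP).
rewrite Rintegral_kapp; apply: le_trans IH.
by apply: bounded_rv_le => [||w]; [exact: coord_rv|exact: coord_rv|exact: Kf].
Qed.

(* 2Bf - f^2 is a Lyapunov function: K decreases it by at least the
   conditional variance of the increment of f. *)
Lemma superharmonic_variation f : (forall x, kapp K f x <= f x) ->
  exists B : R, forall n,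
  \sum_(0 <= t < n) \int[mu]_w `|f (w t.+1) - f (w t)| <= B.
Proof.
move=> Kf; have [B B0 fB] := finfun_bounded f.
(* [m] is at most every nonzero gap between values of [f]; such an [m] exists since [T] is finite,
   and it turns a bound on squared increments into one on absolute increments. *)
have [m m0 mP] : exists2 m : R, 0 < m &
    forall x y, m * `|f y - f x| <= (f y - f x) ^+ 2.
  pose s := [seq `|f z.1 - f z.2| | z <- enum {: T * T} & f z.1 != f z.2].
  have [m m0 mP] : exists2 m : R, 0 < m & forall r, r \in s -> m <= r.
    have : forall r, r \in s -> 0 < r.
      by move=> r /mapP[z]; rewrite mem_filter => /andP[nz _] ->; rewrite normr_gt0 subr_eq0.
    elim: s => [|r s IH] s0; first by exists 1.
    have [x xs|m m0 mP] := IH; first by apply: s0; rewrite inE xs orbT.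
    exists (Num.min m r); first by rewrite lt_min m0 s0 ?mem_head.
    move=> x; rewrite inE => /orP[/eqP ->|/mP mx]; first by rewrite ge_min lexx orbT.
    by rewrite ge_min mx.
  exists m => // x y; have [->|nxy] := eqVneq (f y) (f x).
    by rewrite subrr normr0 mulr0 expr0n.
  rewrite -real_normK ?num_real// expr2 ler_wpM2r//; apply: mP.
  by apply/mapP; exists (y, x) => //; rewrite mem_filter nxy mem_enum.
pose V x := 2 * B * f x - f x ^+ 2.
have VK x : m * kapp K (fun y => `|f y - f x|) x <= V x - kapp K V x.
  have H1 : m * kapp K (fun y => `|f y - f x|) x <= kapp K (fun y => (f y - f x) ^+ 2) x.
    by rewrite -kappZ; apply: kapp_le => // y; exact: mP.
  (* Expanding leads to V - K V = 2 (B - f) (f - K f) + K (f y - f x) ^ 2, where the first term is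
     nonnegative. *)
  have E : kapp K V x = kapp K (fun y =>
      (2 * B - 2 * f x) * f y + (f x ^+ 2 - (f y - f x) ^+ 2)) x.
    by apply: eq_bigr => y _; congr (_ * _); rewrite /V; ring.
  rewrite E kappD kappZ kappB kapp_cst// /V.
  have := fB x; have := Kf x; rewrite ler_norml => h1 /andP[_ h2]; nra.
have [BV BV0 VB] := finfun_bounded V.
exists (m^-1 * (BV + BV)) => n; rewrite ler_pdivlMl// mulr_sumr.
apply: (@le_trans _ _ (\int[mu]_w V (w 0%N) - \int[mu]_w V (w n))).
  elim: n => [|n IH]; first by rewrite big_geq// subrr.
  rewrite big_nat_recr//= (markov_step1 muP n (fun x y => `|f y - f x|)) Rintegral_kapp.
  have b1 := coord_rv n (fun x => kapp K (fun y => `|f y - f x|) x).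
  have : m * \int[mu]_w kapp K (fun y => `|f y - f (w n)|) (w n) <=
      \int[mu]_w V (w n) - \int[mu]_w kapp K V (w n).
    rewrite -(bounded_rv_RintegralZ mu _ b1) -bounded_rv_RintegralB; try exact: coord_rv.
    apply: bounded_rv_le => [||w]; [exact: bounded_rvZ| |exact: VK].
    by apply: bounded_rvB; exact: coord_rv.
  by move: IH; lra.
have := Rintegral_coord_bounded 0 VB; have := Rintegral_coord_bounded n VB; rewrite !ler_norml.
by move=> /andP[h1 h2] /andP[h3 h4]; lra.
Qed.

(** Martingale increments are orthogonal: the cross term vanishes by [markov_step], and each square
    adds at most D ^ 2. *)
Lemma martingale_sqr d (D : R) n : (forall x, kapp K (d x) x = 0) ->
  (forall x y, `|d x y| <= D) ->
  \int[mu]_w (\sum_(0 <= t < n) d (w t) (w t.+1)) ^+ 2 <= n%:R * D ^+ 2.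
Proof.
move=> Kd dD; elim: n => [|n IH].
  by under eq_Rintegral do rewrite big_geq// expr0n; rewrite Rintegral_prob_cst mul0r.
pose M w := \sum_(0 <= t < n) d (w t) (w t.+1).
have aM : adapted n M.
  move=> w w' ww'; apply: eq_big_nat => t /andP[_ tn].
  by rewrite !ww'// ltnW.
have bM := adapted_bounded_rv aM.
have bd : bounded_rv (fun w : trajectory T => d (w n) (w n.+1)).
  exact: adapted_bounded_rv (@adapted_step _ _ n d).
have H w : (\sum_(0 <= t < n.+1) d (w t) (w t.+1)) ^+ 2 =
    M w ^+ 2 + 2 * (M w * d (w n) (w n.+1)) + d (w n) (w n.+1) ^+ 2.
  by rewrite big_nat_recr//= /M; ring.
under eq_Rintegral do rewrite H.
have bMd := bounded_rvM bM bd.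
have bMM : bounded_rv (fun w => M w ^+ 2) := bounded_rvM bM bM.
have bdd : bounded_rv (fun w : trajectory T => d (w n) (w n.+1) ^+ 2).
  exact: (bounded_rvM bd bd).
rewrite bounded_rv_RintegralD//; last by apply: bounded_rvD => //; exact: bounded_rvZ.
rewrite bounded_rv_RintegralD//; last exact: bounded_rvZ.
rewrite bounded_rv_RintegralZ// (markov_step muP d aM).
have -> : \int[mu]_w (M w * kapp K (d (w n)) (w n)) = 0.
  rewrite -(Rintegral_prob_cst mu 0); congr Rintegral; apply/funext => w.
  by rewrite Kd mulr0.
have : \int[mu]_w d (w n) (w n.+1) ^+ 2 <= D ^+ 2.
  rewrite -(Rintegral_prob_cst mu (D ^+ 2)).
  apply: bounded_rv_le => //; first exact: bounded_rv_cst.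
  by move=> w; rewrite -real_normK ?num_real// lerXn2r ?nnegrE// (le_trans _ (dD (w n) (w n.+1))).
by rewrite -natr1 mulrDl mul1r; move: IH; rewrite -/(M _); lra.
Qed.

Lemma average_le f h (e : R) : (forall x, kapp K f x <= f x) ->
  (forall x, mean_cost c K x + kapp K h x <= h x + f x + e) ->
  \int[mu]_w limn_sup (average w) <= \sum_x q x * f x + e.
Proof.
move=> Kf Kh; apply/ler_addgt0Pr => eps eps0; pose eta := eps / 2.
have eta0 : 0 < eta by rewrite divr_gt0.
have [C C0 cC] := costC; have [B B0 fB] := finfun_bounded f.
have [H H0 hH] := finfun_bounded h.
(* Centering c x y + h y under [K x] gives martingale increments; the hypothesis on [h] bounds the
   cost by them, f + e and a telescoping term. *)
pose d x y := c x y + h y - (mean_cost c K x + kapp K h x).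
have Kd x : kapp K (d x) x = 0.
  by rewrite /d kappB kappD kapp_cst// subrr.
have [D D0 dD] : exists2 D : R, 0 <= D & forall x y, `|d x y| <= D.
  have [D D0 dD] := finfun_bounded (fun z : T * T => d z.1 z.2).
  by exists D => // x y; exact: (dD (x, y)).
pose M w n := \sum_(0 <= t < n) d (w t) (w t.+1).
(* The error at index [j]: the variation of [f] at time [j] and the square of the martingale average
   at time j ^ 2. The latter has mean at most a multiple of D ^ 2 / j ^ 2, which is summable. *)
pose psi j w := 2 * `|f (w j.+1) - f (w j)| + 2 / eta * ((j ^ 2)%:R^-1 * M w (j ^ 2)%N) ^+ 2.
have eta2 : 0 <= 2 / eta by rewrite divr_ge0// ltW.
have bf j : bounded_rv (fun w : trajectory T => `|f (w j.+1) - f (w j)|).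
  exact: adapted_bounded_rv (@adapted_step _ _ j (fun x y => `|f y - f x|)).
have bM n : bounded_rv (M ^~ n).
  apply: bounded_rv_sum => t.
  exact: adapted_bounded_rv (@adapted_step _ _ t d).
have bx j : bounded_rv (fun w => ((j ^ 2)%:R^-1 * M w (j ^ 2)%N) ^+ 2).
  by have b := bounded_rvZ (j ^ 2)%:R^-1 (bM (j ^ 2)%N); exact: (bounded_rvM b b).
have [Bf BfP] := superharmonic_variation Kf.
apply: (Rintegral_limn_sup_le (X := fun n w => average w n) (psi := psi) (C := C)
  (Y := fun N w => f (w N) + (e + eps))
  (B := 2 * Bf + 2 / eta * (D ^+ 2 * 2))) => //.
- by move=> n w; exact: average_bound.
- by move=> j; apply: bounded_rvD; apply: bounded_rvZ.
- by move=> j w; rewrite addr_ge0// mulr_ge0// sqr_ge0.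
- move=> n.
  have -> : \sum_(0 <= j < n) \int[mu]_w psi j w =
      2 * \sum_(0 <= j < n) \int[mu]_w `|f (w j.+1) - f (w j)| +
      2 / eta * \sum_(0 <= j < n) \int[mu]_w ((j ^ 2)%:R^-1 * M w (j ^ 2)%N) ^+ 2.
    rewrite !mulr_sumr -big_split; apply: eq_bigr => j _ /=.
    by rewrite bounded_rv_RintegralD ?bounded_rv_RintegralZ//; exact: bounded_rvZ.
  rewrite lerD//; first by rewrite ler_wpM2l.
  rewrite ler_wpM2l//.
  apply: (@le_trans _ _ (\sum_(0 <= j < n) (D ^+ 2 * ((j%:R : R) ^+ 2)^-1))).
    apply: ler_sum => j _.
    have bMM : bounded_rv (fun w => M w (j ^ 2)%N ^+ 2) := bounded_rvM (bM _) (bM _).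
    under eq_Rintegral do rewrite exprMn.
    rewrite bounded_rv_RintegralZ//; have h1 := martingale_sqr (j ^ 2)%N Kd dD.
    apply: (@le_trans _ _ ((j ^ 2)%:R^-1 ^+ 2 * ((j ^ 2)%:R * D ^+ 2))).
      by rewrite ler_wpM2l// sqr_ge0.
    rewrite mulrA mulrC ler_wpM2l ?sqr_ge0// -natrX expr2.
    have [->|j0] := eqVneq ((j ^ 2)%:R : R) 0; first by rewrite invr0 !mulr0.
    by rewrite -mulrA mulVf// mulr1.
  by rewrite -mulr_sumr ler_wpM2l ?sqr_ge0// sum_inv_sqr_le.
- by move=> N; apply: bounded_rvD; [exact: coord_rv|exact: bounded_rv_cst].
- move=> N; rewrite bounded_rv_RintegralD ?Rintegral_prob_cst;
    [|exact: coord_rv|exact: bounded_rv_cst].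
  by rewrite addrA lerD2r lerD2r Rintegral_superharmonic.
- move=> N w tau Stau.
  apply: (limn_sup_le (C := C)); first by move=> n; exact: average_bound.
  have cle t : cost w t <= d (w t) (w t.+1) + f (w t) + e + h (w t) - h (w t.+1).
    by rewrite /d /cost; have := Kh (w t); lra.
  have [N0 N0P] := @path_average_le R (cost w) (fun t => d (w t) (w t.+1))
    (fun t => f (w t)) (fun t => h (w t)) D B H e eta tau N eta0
    (fun t => dD _ _) (fun t => fB _) (fun t => hH _) cle Stau.
  by exists N0 => n /N0P /= h1; apply: (le_trans h1); rewrite /eta; lra.
Qed.

End chain_returns.

(** * Robust Markov decision processes *)

Section robust_policy.
Context (R : realType) (S A : pointedFinType) (M : rmdp R S A).
Hypothesis Mrect : sa_rectangular (uncertainty M).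
Variable pi : policy S A.
Implicit Types (P : transitions R S A).

Let U := uncertainty M.
Let cost (x y : S * A) : R := reward M (x, y.1).
Let q := start M pi.
Let KK := [set transition pi P | P in U].

Let simplex_policy (p : S -> R) : simplex p ->
  simplex (fun x : S * A => p x.1 * (x.2 == pi x.1)%:R).
Proof.
move=> [p0 p1]; split=> [x|]; first by rewrite mulr_ge0.
transitivity (\sum_s \sum_a p s * (a == pi s)%:R).
  by rewrite (pair_bigA _ (fun s a => p s * (a == pi s)%:R)).
rewrite -[RHS]p1; apply: eq_bigr => s _; rewrite (bigD1 (pi s))//= eqxx mulr1.
by rewrite big1 ?addr0// => a /negbTE ->; rewrite mulr0.
Qed.

Let q_simplex : simplex q.
Proof. exact: simplex_policy (initial_simplex M). Qed.

Let KKst K : KK K -> forall x, simplex (K x).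
Proof.
move=> [P UP <-] [s a]; exact: simplex_policy (uncertainty_simplex UP s a).
Qed.

Let KKmix : decomposable KK.
Proof.
move=> _ _ B [P1 UP1 <-] [P2 UP2 <-].
(* Sa-rectangularity enters here: the rows of [P1] and [P2] are mixed according to the state-action
   pair. *)
pose P : transitions R S A := fun z => if B z.1 then P1 z else P2 z.
exists P; last first.
  by apply/funext => x; apply/funext => y; rewrite /transition /P /=; case: ifP.
have [Usa [_ UE]] := Mrect; rewrite /U UE in UP1 UP2 *.
move=> s a; have := UP1 s a; have := UP2 s a; rewrite /next_state /P /=.
by case: (B (s, a)).
Qed.

Let KKultra : ultraclosed KK.
Proof.
move=> I F k FU FKK.
(* Kernels are lifted to members of the uncertainty set, whose compactness gives the limit; indices
   with [k i] outside [KK] receive an arbitrary lift. *)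
have /choice[p pP] : forall i, exists P, KK (k i) -> U P /\ transition pi P = k i.
  move=> i; have [[P UP <-]|nK] := pselect (KK (k i)); first by exists P.
  by have [P _] := uncertainty_nonempty M; exists P.
have Fp : \forall i \near F, U (p i) /\ transition pi (p i) = k i by apply: filterS FKK => i /pP.
have := @uncertainty_compact _ _ _ M; rewrite compact_ultra => /(_ (p @ F) (fmap_ultra _)) [].
  by apply: filterS Fp => i [].
move=> P [UP pcvg]; exists (transition pi P); first by exists P.
move=> x y; have pz : p i (x, y.1) @[i --> F] --> P (x, y.1).
  apply: (cvg_comp p (fun P : transitions R S A => P (x, y.1)) pcvg).
  exact: (@proj_continuous _ (fun _ : S * A * S => R) (x, y.1) P).
have h : transition pi (p i) x y @[i --> F] --> transition pi P x y.
  by apply: cvgM => //; exact: cvg_cst.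
apply: (cvg_trans _ h); apply: near_eq_cvg.
by apply: filterS Fp => i [_ ->].
Qed.

Let KKne : KK !=set0.
Proof. by have [P UP] := uncertainty_nonempty M; exists (transition pi P), P. Qed.

Let costC : exists2 C : R, 0 <= C & forall x y, `|cost x y| <= C.
Proof.
have [C C0 cC] := finfun_bounded (fun z : (S * A) * (S * A) => cost z.1 z.2).
by exists C => // x y; exact: (cC (x, y)).
Qed.

Let discounted_valueE a P v : 0 <= a < 1 -> U P ->
  is_value cost a (transition pi P) v ->
  (1 - a) * discounted_return M a pi P = \sum_x q x * v x.
Proof. by move=> a01 UP vP; exact: (discounted_value (policy_lawP pi UP) a01 vP). Qed.

(** One [P] is optimal from every initial state-action pair at once, hence also after averaging over
    the initial distribution. *)
Lemma optimal_transition a : 0 <= a < 1 -> exists P v, [/\ U P,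
  is_value cost a (transition pi P) v,
  forall L, KK L -> forall x, v x <= (1 - a) * mean_cost cost L x + a * kapp L v x,
  (1 - a) * discounted_return M a pi P = \sum_x q x * v x &
  forall Q, U Q -> \sum_x q x * v x <= (1 - a) * discounted_return M a pi Q].
Proof.
move=> a01; have [_ [v [[P UP <-] vP vopt]]] := optimal_exists cost KKst KKmix KKultra KKne a01.
exists P, v; split => //; first exact: discounted_valueE.
move=> Q UQ; have KQ : KK (transition pi Q) by exists Q.
have [u uQ] := value_exists cost a01 (KKst KQ).
rewrite (discounted_valueE a01 UQ uQ); apply: ler_sum => x _.
apply: ler_wpM2l; first by case: q_simplex.
by apply: (value_le a01 (KKst KQ) _ uQ) => y; exact: vopt.
Qed.

Lemma robust_discounted_cvg :
  inf [set (1 - a) * discounted_return M a pi P | P in U] @[a --> (1 : R)^'-] -->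
  inf [set average_return M pi P | P in U].
Proof.
set w := fun a : R => inf _; set L := inf _.
have [C C0 cC] := costC.
have w01 (a : R) : 0 < a < 1 -> 0 <= a < 1 by move=> /andP[/ltW -> ->].
have /choice[Pv PvP] : forall a : R, exists Pv : transitions R S A * (S * A -> R), 0 < a < 1 ->
    [/\ U Pv.1, is_value cost a (transition pi Pv.1) Pv.2,
    forall L, KK L -> forall x,
      Pv.2 x <= (1 - a) * mean_cost cost L x + a * kapp L Pv.2 x,
    w a = \sum_x q x * Pv.2 x &
    forall Q, U Q -> w a <= (1 - a) * discounted_return M a pi Q].
  move=> a; have [a01|na] := pselect (0 < a < 1 : Prop); last first.
    by have [P _] := uncertainty_nonempty M; exists (P, fun=> 0).
  have [P [v [UP vP vopt vE vle]]] := optimal_transition (w01 _ a01).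
  have wE : w a = \sum_x q x * v x.
    apply/eqP; rewrite eq_le; apply/andP; split.
      rewrite -vE; apply: ge_inf; last by exists P.
      by exists (\sum_x q x * v x) => _ [Q UQ <-]; exact: vle.
    apply: lb_le_inf; first by exists ((1 - a) * discounted_return M a pi P), P.
    by move=> _ [Q UQ <-]; exact: vle.
  by exists (P, v) => _; split => //; rewrite wE.
have avg_inf : has_inf [set average_return M pi P | P in U].
  split; first by have [P UP] := uncertainty_nonempty M; exists (average_return M pi P), P.
  exists (- C) => _ [P UP <-].
  exact: (average_ge (c := cost) (policy_law M pi P) cC).
have near01 : \forall a \near (1 : R)^'-, 0 < a < 1.
  near=> a; apply/andP; split; last by near: a; exact: nbhs_left_lt.
  by near: a; apply: nbhs_left_gt; exact: ltr01.
have upper e : 0 < e -> \forall a \near (1 : R)^'-, w a <= L + e.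
  move=> e0; have e3 : 0 < e / 3 by rewrite divr_gt0.
  (* A single [P], nearly optimal for the average, is tested against all [a]. The three thirds of
     [e] pay for its suboptimality, the passage to the upper limit and the term in 1 - a. *)
  have [_ [P UP <-] avgP] := inf_adherent e3 avg_inf.
  have [B BP] := discounted_le_average cost (policy_lawP pi UP) e3.
  have cvgB : (1 - a) * B @[a --> (1 : R)^'-] --> (1 - 1) * B.
    apply: cvgM; last exact: cvg_cst.
    by apply: cvgB; [exact: cvg_cst|exact: cvg_at_left_filter].
  have nearB : \forall a \near (1 : R)^'-, (1 - a) * B <= e / 3.
    by apply: (cvgr_le _ cvgB); rewrite subrr mul0r.
  apply: filterS2 near01 nearB => a a01 aB.
  have [_ _ _ _ /(_ _ UP) wle] := PvP a a01; apply: (le_trans wle).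
  have KP : KK (transition pi P) by exists P.
  have [u uP] := value_exists cost (w01 _ a01) (KKst KP).
  rewrite (discounted_valueE (w01 _ a01) UP uP).
  by apply: (le_trans (BP a u (w01 _ a01) uP)); move: avgP; rewrite /average_return -/L; lra.
have lower e : 0 < e -> \forall a \near (1 : R)^'-, L - e <= w a.
  move=> e0; apply: contrapT => nlow.
  pose B := [set a : R | w a < L - e].
  (* If the bound is not eventually true, [B] meets every left neighbourhood of 1, so the trace on
     [B] is proper and extends to an ultrafilter. *)
  have WP : ProperFilter (within B (1 : R)^'-).
    apply: Build_ProperFilter_ex => V WV; apply: contrapT => nV; apply: nlow.
    have {}WV : \forall a \near (1 : R)^'-, B a -> V a by exact: WV.
    apply: filterS WV => a Va; rewrite leNgt; apply/negP => aB.
    by apply: nV; exists a; exact: Va.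
  have [F [FU WF]] := ultraFilterLemma WP.
  have F1 : (1 : R)^'- `<=` F by move=> V V1; apply: WF; apply: filterS V1 => a Va _.
  have FB : F B by apply: WF; exact: nearW.
  have F01 : \forall a \near F, 0 < a < 1 by exact: F1.
  have [v vcvg] : exists v : S * A -> R, forall x, (Pv a).2 x @[a --> F] --> v x.
    apply: (@ultra_family_cvg _ _ _ _ _ (fun x a => (Pv a).2 x) C).
    apply: filterS F01 => a a01 x; have [UP vP _ _ _] := PvP a a01.
    apply: (value_bounded (w01 _ a01) (KKst _) cC vP).
    by exists (Pv a).1.
  (* The certificate loses e / 4 twice, in the average and in f <= v + e / 4, so that L <= L - e /
     2, a contradiction. *)
  have e4 : 0 < e / 4 by rewrite divr_gt0.
  have [|||_ [f [h [[P UP <-] Pf Ph fv]]]] := @gain_certificate R _ cost KK KKst KKmix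
    KKultra F FU F1 (fun a => transition pi (Pv a).1) (fun a => (Pv a).2) v _ _ _ vcvg _ e4.
  - by move=> a /PvP[UP _ _ _ _]; exists (Pv a).1.
  - by move=> a /PvP[].
  - by move=> a K x /PvP[_ _ + _ _] KKK; apply.
  have avgle : average_return M pi P <= \sum_x q x * f x + e / 4.
    apply: (average_le (c := cost) _ (policy_lawP pi UP) Pf Ph).
    by apply: KKst; exists P.
  have Lavg : L <= average_return M pi P by apply: ge_inf; [case: avg_inf|exists P].
  have fvle : \sum_x q x * f x <= \sum_x q x * v x + e / 4.
    have [q0 q1] := q_simplex.
    rewrite -[e / 4]mul1r -[X in _ + X * _]q1 mulr_suml -big_split; apply: ler_sum => x _.
    by rewrite /= -mulrDr; apply: ler_wpM2l; [exact: q0|exact: fv].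
  have vle : \sum_x q x * v x <= L - e.
    apply: (cvgr_to_le (f := fun a => \sum_x q x * (Pv a).2 x) (F := F)).
      by apply: cvg_finsum => x; apply: cvgM => //; exact: cvg_cst.
    apply: filterS2 F01 FB => a /PvP[_ _ _ <- _]; exact: ltW.
  have Lv := le_trans (le_trans Lavg avgle) (lerD fvle (lexx (e / 4))).
  have := le_trans Lv (lerD (lerD vle (lexx (e / 4))) (lexx (e / 4))); lra.
apply/cvgrPdist_le => e e0; apply: filterS2 (upper e e0) (lower e e0) => a h1 h2.
by rewrite ler_norml; apply/andP; split; lra.
Unshelve. all: by end_near. Qed.

End robust_policy.

(** Finite maxima are continuous, which reduces the theorem to one policy at a time. *)
Lemma policy_max_cvg (R : realType) (S A : pointedFinType) (I : Type)
    (F : set_system I) (FF : Filter F) (f : I -> policy S A -> R)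
    (g : policy S A -> R) :
  (forall pi, f i pi @[i --> F] --> g pi) ->
  policy_max (f i) @[i --> F] --> policy_max g.
Proof.
move=> fg; rewrite /policy_max; elim: (index_enum _) => [|pi s IH].
  by under eq_fun do rewrite big_nil; rewrite big_nil; exact: fg.
rewrite big_cons; under eq_fun do rewrite big_cons.
apply: continuous2_cvg; [|exact: fg|exact: IH].
exact: (@max_continuous _ R (g pi, _)).
Qed.

(** The first conjunct shows that the inner infimum over the discounted returns is attained, so that
    the [inf] in the second conjunct is a minimum there. *)
Theorem lemma4p8 (R : realType) (S A : pointedFinType) (M : rmdp R S A)
    (Mrect : sa_rectangular (uncertainty M)) :
  (forall (gamma : R) (pi : policy S A), 0 < gamma < 1 ->
     exists2 P, uncertainty M P &
       forall Q, uncertainty M Q ->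
         (1 - gamma) * discounted_return M gamma pi P <=
         (1 - gamma) * discounted_return M gamma pi Q)
  /\
  policy_max (fun pi : policy S A =>
      inf [set (1 - gamma) * discounted_return M gamma pi P
          | P in uncertainty M])
    @[gamma --> (1 : R)^'-]
  --> policy_max (fun pi : policy S A =>
      inf [set average_return M pi P | P in uncertainty M]).
Proof.
split=> [gamma pi /andP[/ltW g0 g1]|].
  have g01 : 0 <= gamma < 1 by rewrite g0.
  have [P [v [UP _ _ <- vle]]] := optimal_transition Mrect pi g01.
  by exists P.
by apply: policy_max_cvg => pi; exact: robust_discounted_cvg.
Qed.
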